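(* Let $X$ be a real complete Hausdorff locally convex space with topological dual $X^*$. Let $f:X\to\mathbb{R}\cup\{+\infty\}$ be a proper lower semicontinuous convex function and let $U$ be a nonempty subset of $X^*$ that is open with respect to the Mackey topology $\tau(X^*,X)$. Then the following statements are equivalent: (a) $f$ is epi-pointed and $U\subseteq\operatorname{dom} f^*$; (b) $f-x^*$ is weakly inf-compact for all $x^*\in U$; (c) $(\partial f)^{-1}(x^* )\ne\emptyset$ for all $x^*\in U$.
   Context: $\langle x^*,x\rangle:=x^*(x)$ for $x^*\in X^*$, $x\in X$. The Mackey topology $\tau(X^*,X)$ on $X^*$ is the topology having as a basis of neighborhoods of zero the polar sets $\{x^*\in X^*: \sup_{x\in K}\langle x^*,x\rangle\le 1\}$ of all weakly compact circled (balanced) convex sets $K\subseteq X$. The domain of a function $g$ with values in $\mathbb{R}\cup\{+\infty\}$ is $\operatorname{dom} g:=\{g<+\infty\}$, and $g$ is proper if $\operatorname{dom} g\neq\emptyset$. The conjugate of $f$ is $f^*(x^* ):=\sup_{x\in X}(\langle x^*,x\rangle-f(x))$, $x^*\in X^*$. The function $f$ is epi-pointed if $f^*$ is proper and $\tau(X^*,X)$-continuous at some point of its domain. A function $g:X\to\mathbb{R}\cup\{+\infty\}$ is weakly inf-compact if for every $\lambda\in\mathbb{R}$ the sublevel set $\{x\in X: g(x)\le\lambda\}$ is weakly compact. The subdifferential is $\partial f(x):=\{x^*\in X^*:\langle x^*,y-x\rangle+f(x)\le f(y)\ \forall y\in X\}$ if $f(x)$ is finite, and $\partial f(x):=\emptyset$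 otherwise; $(\partial f)^{-1}(x^* ):=\{x\in X: x^*\in\partial f(x)\}$. *)

(* Defs.v *)
From HB Require Import structures.
From mathcomp Require Import all_boot all_order all_algebra.
From mathcomp Require Import all_classical all_reals all_analysis.
From mathcomp Require Import lra.

Set Implicit Arguments.
Unset Strict Implicit.
Unset Printing Implicit Defensive.

Import Order.TTheory GRing.Theory Num.Theory.
Import numFieldNormedType.Exports.

Local Open Scope classical_set_scope.
Local Open Scope ring_scope.

(* Completeness with respect to the uniformity induced by the translations.
   [tvsType] only asks its uniformity to be compatible with the topology, not
   with the addition, so the library's [cauchy] is not the right notion here. *)
Section completeness.
Context {R : realType} (X : tvsType R).

Definition tvs_cauchy (F : set_system X) : Prop :=
  forall V : set X, nbhs (0 : X) V ->
    exists2 A, F A & forall x y, A x -> A y -> V (x - y).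

Definition tvs_complete : Prop :=
  forall F : set_system X, ProperFilter F -> tvs_cauchy F ->
    exists x : X, F --> x.

End completeness.

Section dual.
Context {R : realType} (X : tvsType R).

Definition continuous_linear : {pred X -> R^o} :=
  fun g => `[< linear g /\ continuous g >].

Lemma continuous_linear_submod_closed : submod_closed continuous_linear.
Proof.
split.
  by apply/asboolP; split=> [a x y|]; [rewrite /= scaler0 addr0|exact: cst_continuous].
move=> a g h /asboolP[lg cg] /asboolP[lh ch]; apply/asboolP; split.
  move=> b x y; rewrite /= !fctE lg lh !scalerDr !scalerA mulrC.
  by rewrite addrACA.
by move=> x; apply: (@cvgD _ R^o); [apply: cvgZl_tmp; exact: cg|exact: ch].
Qed.

HB.instance Definition _ :=
  GRing.isSubmodClosed.Build R (X -> R^o) continuous_linear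
    continuous_linear_submod_closed.

Record dual : Type := Dual {
  dual_fun :> X -> R^o;
  dual_funP : dual_fun \in continuous_linear
}.

HB.instance Definition _ := [isSub for dual_fun].
HB.instance Definition _ := [Choice of dual by <:].
HB.instance Definition _ := [SubChoice_isSubLmodule of dual by <:].

Lemma dual_linear (xs : dual) : linear xs.
Proof. by case: xs => g /= /asboolP[]. Qed.

Lemma dual_continuous (xs : dual) : continuous xs.
Proof. by case: xs => g /= /asboolP[]. Qed.

HB.instance Definition _ (xs : dual) :=
  GRing.isLinear.Build R X R^o *:%R xs (dual_linear xs).

End dual.

Section weak.
Context {R : realType} (X : tvsType R).

Definition weak : Type :=
  sup_topology (fun xs : dual X => Topological.on (initial_topology xs)).

HB.instance Definition _ := Topological.on weak.

Definition weakly_compact (K : set X) : Prop := compact (K : set weak).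

Definition circled (K : set X) : Prop :=
  forall (t : R) x, `|t| <= 1 -> K x -> K (t *: x).

End weak.

Section weak_compactness.
Context {R : realType} {X : tvsType R}.
Implicit Types (K L : set X) (t : R).

Lemma cvg_weak (F : set_system X) (x : X) : Filter F ->
  (F --> (x : weak X)) <->
  (forall xs : dual X, (xs y : R^o) @[y --> F] --> (xs x : R^o)).
Proof.
move=> FF; split=> [/cvg_sup Fx xs|Fx].
  have cxs := @initial_continuous X R^o xs (x : initial_topology xs).
  exact: (cvg_trans (cvg_app xs (Fx xs)) cxs).
apply/cvg_sup => xs A /=; rewrite (@nbhsE (initial_topology xs)).
move=> [B [[C oC <-] Cx] BA]; apply: (@filterS _ F _ _ _ BA).
by apply: (Fx xs); exact: open_nbhs_nbhs.
Qed.

Lemma weak_dual_continuous (xs : dual X) (x : X) :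
  (xs y : R^o) @[y --> (x : weak X)] --> (xs x : R^o).
Proof. by apply: (iffLR (@cvg_weak (nbhs (x : weak X)) x _)). Qed.

Lemma weakly_compact_add K L : weakly_compact K -> weakly_compact L ->
  weakly_compact [set x + y | x in K & y in L].
Proof.
move=> cK cL; have cKL := compact_setX cK cL.
suff /continuous_compact/(_ cKL) : {within (K `*` L : set (weak X * weak X)),
    continuous (fun z : weak X * weak X => (z.1 : X) + z.2 : weak X)}.
  by rewrite /weakly_compact image2E; congr compact; apply: eq_imagel => -[].
apply: continuous_subspaceT => -[x y] /=; apply/cvg_weak => xs /=.
have cx := @cvg_fst _ _ (nbhs (x : weak X)) (nbhs (y : weak X)) _.
have cy := @cvg_snd _ _ (nbhs (x : weak X)) (nbhs (y : weak X)) _.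
suff h : (xs z.1 + xs z.2 : R^o) @[z --> ((x, y) : weak X * weak X)] -->
    (xs x + xs y : R^o).
  rewrite linearD => A /h.
  by apply: (@filterS _ (nbhs ((x, y) : weak X * weak X))) => z /=; rewrite linearD.
apply: (@cvgD _ R^o).
  by move=> A /weak_dual_continuous /cx.
by move=> A /weak_dual_continuous /cy.
Qed.

Lemma weakly_compact_scale K t :
  weakly_compact K -> weakly_compact [set t *: x | x in K].
Proof.
move=> cK; apply: continuous_compact cK.
apply: continuous_subspaceT => x /=.
have FF := fmap_filter (fun y : X => t *: y) (nbhs_filter (x : weak X)).
apply/(@cvg_weak _ _ FF) => xs /=.
suff h : (t * xs y : R^o) @[y --> (x : weak X)] --> (t * xs x : R^o).
  rewrite linearZ => A /h.
  by apply: (@filterS _ (nbhs (x : weak X))) => y /=; rewrite linearZ.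
apply: (@cvgZl_tmp _ R^o _ (nbhs (x : weak X))); exact: weak_dual_continuous.
Qed.

End weak_compactness.

(* The topology carried by [dual X] is the Mackey topology tau(X^*, X). *)
Section mackey.
Context {R : realType} {X : tvsType R}.
Implicit Types (K L : set X) (xs ys : dual X).

Definition polar K : set (dual X) :=
  [set xs : dual X | (ereal_sup [set (xs x : R)%:E | x in K] <= 1)%E].

Lemma polarP K xs : polar K xs <-> forall x, K x -> (xs x : R) <= 1.
Proof.
split=> [Kxs x Kx|Kxs].
  by rewrite -lee_fin; apply: le_trans Kxs; apply: ereal_sup_ubound; exists x.
by apply: ge_ereal_sup => _ [x Kx <-]; rewrite lee_fin; exact: Kxs.
Qed.

Definition mackey_set K : Prop :=
  [/\ weakly_compact K, circled K & convex_set K].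

Definition mackey_nbhs xs : set_system (dual X) :=
  filter_from mackey_set (fun K => [set ys | polar K (ys - xs)]).

HB.instance Definition _ := hasNbhs.Build (dual X) mackey_nbhs.

Lemma mackey_set0 : mackey_set set0.
Proof.
by split; [exact: compact0|move=> t x _ []|move=> x y t; rewrite inE].
Qed.

Lemma mackey_setD K L : mackey_set K -> mackey_set L ->
  mackey_set [set x + y | x in K & y in L].
Proof.
move=> [cK bK vK] [cL bL vL]; split; first exact: weakly_compact_add.
  move=> t _ t1 [x Kx [y Ly <-]]; exists (t *: x); first exact: bK.
  by exists (t *: y); [exact: bL|rewrite scalerDr].
move=> _ _ t /set_mem[x Kx [y Ly <-]] /set_mem[x' Kx' [y' Ly' <-]].
apply/mem_set; exists (t%:inum *: x + (1 - t%:inum) *: x').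
  by apply: set_mem; apply: vK; exact: mem_set.
exists (t%:inum *: y + (1 - t%:inum) *: y').
  by apply: set_mem; apply: vL; exact: mem_set.
by rewrite [RHS]/conv/= !scalerDr addrACA.
Qed.

Lemma mackey_setZ K (a : R) : mackey_set K -> mackey_set [set a *: x | x in K].
Proof.
move=> [cK bK vK]; split; first exact: weakly_compact_scale.
  move=> t _ t1 [x Kx <-]; exists (t *: x); first exact: bK.
  by rewrite !scalerA mulrC.
move=> _ _ t /set_mem[x Kx <-] /set_mem[y Ky <-]; apply/mem_set.
exists (t%:inum *: x + (1 - t%:inum) *: y).
  by apply: set_mem; apply: vK; exact: mem_set.
by rewrite [RHS]/conv/= scalerDr !scalerA mulrC [a * _]mulrC.
Qed.

Lemma mackey_setI K L : mackey_set K -> mackey_set L ->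
  exists2 M, mackey_set M & polar M `<=` polar K `&` polar L.
Proof.
move=> mK mL.
have circled0 (J : set X) : mackey_set J -> J !=set0 -> J 0.
  by move=> [_ bJ _] [x Jx]; rewrite -(scale0r x); apply: bJ; rewrite ?normr0.
have [->|/set0P K0] := eqVneq K set0.
  by exists L => // xs Lxs; split => //; apply/polarP.
have [->|/set0P L0] := eqVneq L set0.
  by exists K => // xs Kxs; split => //; apply/polarP.
exists [set x + y | x in K & y in L]; first exact: mackey_setD.
move=> xs /polarP KLxs; split; apply/polarP => x Jx; apply: KLxs.
  by exists x => //; exists 0; [exact: circled0|rewrite addr0].
by exists 0; [exact: circled0|exists x => //; rewrite add0r].
Qed.

Lemma mackey_nbhs_singleton xs (A : set (dual X)) : mackey_nbhs xs A -> A xs.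
Proof.
by move=> [K _]; apply; apply/polarP => x _; rewrite subrr ler01.
Qed.

Lemma mackey_nbhs_filter xs : ProperFilter (mackey_nbhs xs).
Proof.
apply: filter_from_proper; last first.
  by move=> K _; exists xs; apply/polarP => x _; rewrite subrr ler01.
apply: filter_from_filter; first by exists set0; exact: mackey_set0.
by move=> K L /mackey_setI/[apply] -[M mM MKL]; exists M => // ys /MKL.
Qed.

Lemma mackey_nbhs_nbhs xs (A : set (dual X)) :
  mackey_nbhs xs A -> mackey_nbhs xs (mackey_nbhs^~ A).
Proof.
move=> [K mK KA]; have m2K := mackey_setZ 2 mK.
exists [set 2 *: x | x in K] => // ys /polarP Kys.
exists [set 2 *: x | x in K] => // zs /polarP Kzs.
apply: KA; apply/polarP => x Kx.
have /Kys := imageP ( *:%R 2) Kx; have /Kzs := imageP ( *:%R 2) Kx.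
rewrite !linearZ /= => zx yx.
have {}zx : 2 * ((zs x : R) - ys x) <= 1 by exact: zx.
have {}yx : 2 * ((ys x : R) - xs x) <= 1 by exact: yx.
suff : (zs x : R) - xs x <= 1 by [].
by lra.
Qed.

HB.instance Definition _ := Nbhs_isNbhsTopological.Build (dual X)
  mackey_nbhs_filter mackey_nbhs_singleton mackey_nbhs_nbhs.

End mackey.

Section convex_analysis.
Context {R : realType}.
Local Open Scope ereal_scope.

Definition dom {T : Type} (g : T -> \bar R) : set T := [set x | g x < +oo].

(* The first conjunct says that g takes its values in R u {+oo}. *)
Definition proper_efun {T : Type} (g : T -> \bar R) : Prop :=
  (forall x, g x != -oo) /\ dom g !=set0.

Context {X : tvsType R}.
Implicit Types (f g : X -> \bar R) (xs : dual X).

(* Used only for g > -oo; then the convention 0 * +oo = 0 makes the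
   inequality trivial at t = 0 and t = 1. *)
Definition convex_efun g : Prop :=
  forall (x y : X) (t : R), (0 <= t <= 1)%R ->
    g (t *: x + (1 - t) *: y)%R <= t%:E * g x + (1 - t)%:E * g y.

Definition conjugate f : dual X -> \bar R :=
  fun xs => ereal_sup [set (xs x : R)%:E - f x | x in [set: X]].

Definition epi_pointed f : Prop :=
  proper_efun (conjugate f) /\
  exists2 xs, dom (conjugate f) xs & {for xs, continuous (conjugate f)}.

Definition weakly_inf_compact g : Prop :=
  forall lam : R, weakly_compact [set x | g x <= lam%:E].

Definition subdifferential f (x : X) : set (dual X) :=
  [set xs : dual X | f x \is a fin_num /\
            forall y : X, (xs (y - x)%R : R)%:E + f x <= f y].

Definition inv_subdifferential f xs : set X :=
  [set x | subdifferential f x xs].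

End convex_analysis.

(* Main.v *)
(** The heart of the matter is James' theorem in a complete locally convex
    space: if every [y] in the dual attains its maximum on [A], then every
    ultrafilter on [A] converges weakly. The limit [phi] along the ultrafilter is
    a linear form on the dual. Were it not a uniform limit of points of [X] on
    some equicontinuous set, Helly's theorem would yield [y_n] in that set and
    [x_n] in [A] with [y_n(x_k) = 0] for [k < n] and [y_n(x_k) >= theta] for
    [n <= k]. Following Pryce, after passing to a subsequence of [y_n], suprema
    over [A] do not distinguish liminf [y_n] from limsup [y_n]; then suitable
    averages [w_n] of the [y_n] and a cluster point [w] of them make the
    functional [sum_n q^n (w_n - w)] attain its maximum at no point of [A].

    The theorem for functions is reduced to the one for sets by perspective.
    Normalise [f(0) = 0 = min f] and assume that [f - y] attains its minimum for
    all [y] in the polar of a weakly compact circled set [K]. Every [y] attains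
    its maximum on [{x / (f(x) + 1)} u K]: if the maximum over [K] does not win,
    [y] can be rescaled into the interior of the polar of [K]. The sublevel set
    [f <= lam] lies in [[1, lam + 1]] times this set, which gives (c) => (b).

    The remaining implications are Moreau's duality between Mackey continuity of
    the conjugate and weak inf-compactness. *)
Require Import Defs.
From HB Require Import structures.
From mathcomp Require Import all_boot all_order all_algebra.
From mathcomp Require Import all_classical all_reals all_analysis.
From mathcomp Require Import ring lra.

Import Order.TTheory GRing.Theory Num.Theory.
Import numFieldNormedType.Exports.

Local Open Scope classical_set_scope.
Local Open Scope ring_scope.

Set Implicit Arguments.
Unset Strict Implicit.
Unset Printing Implicit Defensive.

(** * The Hahn-Banach theorem *)

Section hahn_banach.
Context {R : realType} {X : lmodType R}.
Implicit Types (p q : X -> R) (C : set X).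

Definition sublinear p : Prop :=
  (forall x y, p (x + y) <= p x + p y) /\
  (forall (t : R) x, 0 <= t -> p (t *: x) = t * p x).

(** Two real weights replace the interval-typed weight of [convex_set], so that quotients such as
    [s / (s + t)] can be used as weights directly. *)
Definition segment_convex C : Prop :=
  forall x y (s t : R), C x -> C y -> 0 <= s -> 0 <= t -> s + t = 1 ->
    C (s *: x + t *: y).

Lemma sublinear0 p : sublinear p -> p 0 = 0.
Proof. by move=> [_ /(_ 0 0 (lexx _))]; rewrite scaler0 mul0r. Qed.

Lemma sublinear_geN p x : sublinear p -> - p (- x) <= p x.
Proof.
move=> sp; have [pD _] := sp; have := pD x (- x).
by rewrite subrr (sublinear0 sp) -lerBlDr sub0r.
Qed.

Lemma sublinear_lower (p q : X -> R) x : sublinear q -> (forall x, q x <= p x) ->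
  - p (- x) <= q x.
Proof.
by move=> sq qp; apply: le_trans (sublinear_geN x sq); rewrite lerN2.
Qed.

(* Besides lowering [p] on [- C], this is what makes a minimal sublinear function
   linear: take [C = [set x]] and [a = p x], so that minimality gives
   [p (- x) <= - p x]. *)
Lemma sublinear_twist p C (a : R) : sublinear p -> C !=set0 -> segment_convex C ->
    (forall c, C c -> a <= p c) ->
  exists q, [/\ sublinear q, forall x, q x <= p x & forall c, C c -> q (- c) <= - a].
Proof.
move=> sp [c0 Cc0] vC ap; have [pD pZ] := sp.
(* The infimum [q] of these values is the largest sublinear function below [p] with [q (- c) <= - a]
   on [C]: any such [q'] satisfies [q' z <= q' (z + t *: c) + t * q' (- c)]. *)
pose E z := [set r | exists t c, [/\ 0 <= t, C c & r = p (z + t *: c) - t * a]].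
pose q z := inf (E z).
have Elb z : lbound (E z) (- p (- z)).
  move=> _ [t [c [t0 Cc ->]]]; have := pD (z + t *: c) (- z).
  rewrite addrAC subrr add0r pZ// => h.
  by have := ler_wpM2l t0 (ap _ Cc); lra.
have hE z : has_lbound (E z) by exists (- p (- z)).
have E0 z : E z !=set0 by exists (p (z + 0 *: c0) - 0 * a), 0, c0.
have qle z t c : 0 <= t -> C c -> q z <= p (z + t *: c) - t * a.
  by move=> t0 Cc; apply: ge_inf => //; exists t, c.
have qge z r : (forall t c, 0 <= t -> C c -> r <= p (z + t *: c) - t * a) -> r <= q z.
  by move=> h; apply: lb_le_inf => // _ [t [c [t0 Cc ->]]]; exact: h.
exists q; split; last 2 first.
- by move=> x; have := qle x 0 c0 (lexx _) Cc0; rewrite scale0r addr0 mul0r subr0.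
- move=> c Cc; have := qle (- c) 1 c ler01 Cc.
  by rewrite scale1r addNr (sublinear0 sp) mul1r sub0r.
have qD x y : q (x + y) <= q x + q y.
  rewrite -lerBlDr; apply: (qge) => t c t0 Cc; rewrite lerBlDr -lerBlDl.
  apply: (qge) => s d s0 Cd; rewrite lerBlDl.
  have [st0|] := eqVneq (s + t) 0.
    have [-> ->] : s = 0 /\ t = 0 by lra.
    rewrite !scale0r !addr0 !mul0r !subr0; apply: le_trans (pD _ _).
    by have := qle (y + x) 0 c (lexx _) Cc; rewrite scale0r addr0 mul0r subr0 addrC.
  move=> st0; have Ce : C ((s / (s + t)) *: d + (t / (s + t)) *: c).
    by apply: vC => //; rewrite ?divr_ge0 ?addr_ge0// -mulrDl divff.
  have := qle (x + y) (s + t) _ (addr_ge0 s0 t0) Ce; move/le_trans; apply.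
  rewrite scalerDr !scalerA !(mulrCA (s + t)) divff// !mulr1 [x + y]addrC addrACA.
  by have := pD (y + s *: d) (x + t *: c); lra.
have qZ1 t x : 0 < t -> q (t *: x) <= t * q x.
  move=> t0; rewrite mulrC -ler_pdivrMr//; apply: (qge) => s c s0 Cc.
  rewrite ler_pdivrMr//; have := qle (t *: x) (t * s) c (mulr_ge0 (ltW t0) s0) Cc.
  by rewrite -scalerA -scalerDr (pZ _ _ (ltW t0)) => /le_trans; apply; lra.
have q0 : q 0 = 0.
  apply/eqP; rewrite eq_le; apply/andP; split.
    have := qle 0 0 c0 (lexx _) Cc0.
    by rewrite scale0r addr0 mul0r subr0 (sublinear0 sp).
  apply: (qge) => t c t0 Cc; rewrite add0r pZ// subr_ge0.
  by apply: ler_wpM2l => //; exact: ap.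
split=> // t x; rewrite le_eqVlt => /predU1P[<-|t0].
  by rewrite scale0r mul0r q0.
apply/eqP; rewrite eq_le qZ1//=.
have := qZ1 t^-1 (t *: x); rewrite invr_gt0 t0 scalerA mulVf ?gt_eqF// scale1r.
by move=> /(_ isT); rewrite mulrC ler_pdivlMr// mulrC.
Qed.

(** Zorn's lemma. The pointwise infimum of a chain is finite by [sublinear_lower], and subadditive
    because the smaller of two members of the chain serves both summands. *)
Lemma sublinear_minimal p : sublinear p -> exists q,
  [/\ sublinear q, forall x, q x <= p x &
      forall q', sublinear q' -> (forall x, q' x <= q x) -> q' = q].
Proof.
move=> sp.
pose T := {q : X -> R | sublinear q /\ (forall x, q x <= p x)}.
(* The order is reversed: maximal for [r] means pointwise minimal. *)
pose r (s t : T) := `[< forall x, sval t x <= sval s x >].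
have [|||A totA|[m [sm mp]] mmax] := @Zorn T r.
- by move=> t; apply/asboolP.
- move=> t1 t2 t3 /asboolP h1 /asboolP h2; apply/asboolP => x.
  exact: le_trans (h2 x) (h1 x).
- move=> [s Hs] [t Ht] /asboolP /= h1 /asboolP /= h2.
  by apply: eq_exist; apply/funext => x; apply/eqP; rewrite eq_le h1 h2.
- have [[t0 At0]|A0] := pselect (A !=set0); last first.
    by exists (exist _ p (conj sp (fun x => lexx (p x)))) => s As; case: A0; exists s.
  pose E x := [set (sval t x) | t in A].
  have hE x : has_lbound (E x).
    exists (- p (- x)) => _ [[t [st tp]] At <-] /=.
    exact: sublinear_lower st tp.
  have ge x t : A t -> inf (E x) <= sval t x.
    by move=> At; apply: ge_inf => //; exists t.
  have qge x b : (forall t, A t -> b <= sval t x) -> b <= inf (E x).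
    by move=> h; apply: lb_le_inf => [|_ [t At <-]]; [exists (sval t0 x), t0|exact: h].
  have sl : sublinear (fun x => inf (E x)).
    split=> [x y|t x t0'].
      rewrite -lerBlDr; apply: (qge) => t At; rewrite lerBlDr -lerBlDl.
      apply: (qge) => s As; rewrite lerBlDl.
      have [/asboolP h|/asboolP h] := totA _ _ At As.
        apply: le_trans (ge _ _ As) _; have [[sD _] _] := svalP s.
        by apply: le_trans (sD _ _) _; apply: lerD => //; exact: h.
      apply: le_trans (ge _ _ At) _; have [[sD _] _] := svalP t.
    by apply: le_trans (sD _ _) _; apply: lerD => //; exact: h.
    have sZ s : A s -> sval s (t *: x) = t * sval s x.
      by move=> As; have [[_ ->]] := svalP s.
    move: t0'; rewrite le_eqVlt => /predU1P[t00|t0'].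
      apply/eqP; rewrite eq_le -t00 mul0r; apply/andP; split.
        by apply: le_trans (ge _ _ At0) _; rewrite t00 sZ// -t00 mul0r.
      by apply: (qge) => s As; rewrite t00 sZ// -t00 mul0r.
    apply/eqP; rewrite eq_le; apply/andP; split.
      rewrite mulrC -ler_pdivrMr//; apply: (qge) => s As.
      by rewrite ler_pdivrMr// mulrC -sZ//; exact: ge.
    by apply: (qge) => s As; rewrite sZ// ler_pM2l//; exact: ge.
  have lp x : inf (E x) <= p x.
    by apply: le_trans (ge _ _ At0) _; have [_] := svalP t0.
  pose t : T := exist (fun q => sublinear q /\ (forall x, q x <= p x)) _ (conj sl lp).
  by exists t => s As; apply/asboolP => x /=; exact: ge.
exists m; split => // q' sq' q'm.
have q'p x : q' x <= p x by apply: le_trans (mp x).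
pose t' : T := exist (fun q => sublinear q /\ (forall x, q x <= p x)) q' (conj sq' q'p).
by have /(congr1 sval) := mmax t' (asboolT q'm).
Qed.

(** The common source of norming functionals ([C] a point) and of separation ([C] a translated
    convex set). After twisting [p] along [C], a minimal sublinear function below it is linear, and
    [m (- c) <= - a] turns into [a <= m c]. *)
Lemma mazur_orlicz p C (a : R) : sublinear p -> C !=set0 -> segment_convex C ->
    (forall c, C c -> a <= p c) ->
  exists g : X -> R^o, [/\ linear g, forall x, g x <= p x & forall c, C c -> a <= g c].
Proof.
move=> sp C0 vC ap.
have [q [sq qp qC]] := sublinear_twist sp C0 vC ap.
have [m [sm mq mmin]] := sublinear_minimal sq.
have mN x : m (- x) = - m x.
  have [|||m' [sm' m'm m'x]] := @sublinear_twist m [set x] (m x) sm.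
  - by exists x.
  - by move=> _ _ s t -> -> _ _ st; rewrite -scalerDl st scale1r.
  - by move=> _ ->.
  apply/eqP; rewrite eq_le; apply/andP; split.
    by rewrite -{1}(mmin _ sm' m'm); exact: m'x.
  by have := sublinear_geN (- x) sm; rewrite opprK.
have [mD mZ] := sm.
have mD' x y : m (x + y) = m x + m y.
  apply/eqP; rewrite eq_le mD/=.
  by have := mD (- x) (- y); rewrite -opprD !mN; lra.
exists m; split.
- move=> t x y; rewrite mD'; congr (_ + _).
  have [t0|t0] := leP 0 t; first by rewrite mZ.
  rewrite -[t]opprK scaleNr mN mZ ?oppr_ge0 ?ltW//.
  by rewrite -[RHS]/(- - t * m x) mulNr.
- by move=> x; exact: le_trans (qp x).
- by move=> c Cc; have := le_trans (mq _) (qC _ Cc); rewrite mN lerN2.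
Qed.

End hahn_banach.

(** * Seminorms and separation *)

Section seminorms.
Context {R : realType} {X : tvsType R}.
Implicit Types (p : X -> R) (x : X) (V C : set X).

(** A continuous seminorm. Continuity is encoded by the unit ball being a neighbourhood of 0;
    homogeneity spreads this to all centres and radii in [cseminorm_nbhs]. *)
Definition cseminorm p : Prop :=
  [/\ sublinear p, forall x, p (- x) = p x & nbhs (0 : X) [set x | p x <= 1]].

Lemma cseminorm_ge0 p x : cseminorm p -> 0 <= p x.
Proof. by move=> [sp pN _]; have := sublinear_geN x sp; rewrite pN; lra. Qed.

Lemma cseminorm_nbhs p x (e : R) : cseminorm p -> 0 < e ->
  nbhs x [set z | p (z - x) <= e].
Proof.
move=> [[_ pZ] pN p1] e0.
have := nbhsT x (nbhs0Z (lt0r_neq0 e0) p1).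
apply: filterS => _ [_ [z /= pz <-] <-].
by rewrite addrAC subrr add0r (pZ _ _ (ltW e0)) ger_pMr.
Qed.

Lemma cseminorm_scale p (c : R) : 0 < c -> cseminorm p ->
  cseminorm (fun x => c * p x).
Proof.
move=> c0 cp; have [[pD pZ] pN p1] := cp; split.
- by split=> [x y|t x t0]; [rewrite -mulrDr ler_pM2l|rewrite pZ// mulrCA].
- by move=> x; rewrite pN.
- have := cseminorm_nbhs 0 cp (ltac:(by rewrite invr_gt0) : 0 < c^-1).
  by apply: filterS => z /=; rewrite subr0 -(ler_pM2l c0) divff// gt_eqF.
Qed.

Lemma cseminorm_add p q : cseminorm p -> cseminorm q ->
  cseminorm (fun x => p x + q x).
Proof.
move=> cp cq; have [[pD pZ] pN p1] := cp; have [[qD qZ] qN q1] := cq; split.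
- split=> [x y|t x t0]; first by have := pD x y; have := qD x y; lra.
  by rewrite pZ// qZ// mulrDr.
- by move=> x; rewrite pN qN.
- have e : 0 < 2^-1 :> R by rewrite invr_gt0.
  apply: filterS2 (cseminorm_nbhs 0 cp e) (cseminorm_nbhs 0 cq e) => z /=.
  by rewrite subr0; lra.
Qed.

Lemma nbhs0_absorbing V x : nbhs (0 : X) V ->
  exists2 t : R, 0 < t & V (t *: x).
Proof.
move=> V0; have /= := @scale_continuous _ X (0, x) V.
rewrite scale0r => /(_ V0)[[A B] /= [[e /= e0 Ae] Bx] AB].
exists (e / 2); first by rewrite divr_gt0.
have := AB (e / 2, x); apply; split=> /=; last exact: nbhs_singleton.
by apply: Ae; rewrite /= sub0r normrN gtr0_norm ?divr_gt0//; lra.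
Qed.

Lemma segment_convexP C : convex_set C -> segment_convex C.
Proof.
move=> vC x y s t Cx Cy s0 t0 st.
have s01 : (0 <= s <= 1)%R by rewrite s0/=; lra.
have := vC x y (Itv01 s0 (andP s01).2) (mem_set Cx) (mem_set Cy).
have -> : t = 1 - s by lra.
by move=> /set_mem.
Qed.

Lemma nbhs0_convex V : nbhs (0 : X) V ->
  exists W, [/\ nbhs (0 : X) W, segment_convex W & W `<=` V].
Proof.
move=> V0; have [B cB [oB bB]] := @locally_convex R X.
have [W [BW W0] WV] := bB 0 V V0.
exists W; split => //; first by apply: open_nbhs_nbhs; split => //; exact: oB.
by apply: segment_convexP; apply: cB; rewrite inE.
Qed.

(** The Minkowski gauge of [W'], the intersection of a convex neighbourhood with its opposite. If
    [p x < 1], some [t < 1] has [t^-1 *: x] in [W'], and [x] lies between this point and 0. *)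
Lemma nbhs0_cseminorm V : nbhs (0 : X) V ->
  exists2 p, cseminorm p & forall x, p x < 1 -> V x.
Proof.
move=> /nbhs0_convex[W [W0 vW WV]].
pose W' := W `&` [set - x | x in W].
have W'0 : nbhs (0 : X) W' by apply: filterI => //; exact: nbhs0N.
have W'N x : W' x -> W' (- x).
  by move=> [Wx [y Wy yx]]; split; [rewrite -yx opprK|exists x].
have vW' : segment_convex W'.
  move=> x y s t [Wx [x' Wx' xx]] [Wy [y' Wy' yy]] s0 t0 st; split.
    exact: vW.
  exists (s *: x' + t *: y'); first exact: vW.
  by rewrite opprD -!scalerN xx yy.
have W'1 := nbhs_singleton W'0.
pose E x := [set t : R | 0 < t /\ W' (t^-1 *: x)].
pose p x := inf (E x).
have Elb x : has_lbound (E x) by exists 0 => t [/ltW].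
have E0 x : E x !=set0.
  have [t t0 Wt] := nbhs0_absorbing x W'0.
  by exists t^-1; split; rewrite ?invr_gt0// invrK.
have ple x t : 0 < t -> W' (t^-1 *: x) -> p x <= t.
  by move=> t0 Wt; apply: ge_inf.
have pge x r : (forall t, 0 < t -> W' (t^-1 *: x) -> r <= t) -> r <= p x.
  by move=> h; apply: lb_le_inf => // t [t0 Wt]; exact: h.
have p0 x : 0 <= p x by apply: (pge) => t /ltW.
have pD x y : p (x + y) <= p x + p y.
  rewrite -lerBlDr; apply: (pge) => t t0 Wt; rewrite lerBlDr -lerBlDl.
  apply: (pge) => s s0 Ws; rewrite lerBlDl; apply: ple; first exact: addr_gt0.
  have ts : t + s != 0 by rewrite gt_eqF ?addr_gt0.
  have := vW' _ _ (t / (t + s)) (s / (t + s)) Wt Ws.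
  have ts0 := ltW (addr_gt0 t0 s0).
  rewrite !(divr_ge0 _ ts0) ?(ltW t0) ?(ltW s0)//.
  rewrite !scalerA -mulrDl divff// => /(_ isT isT erefl).
  rewrite !(mulrAC _ (t + s)^-1) !divff ?(gt_eqF t0) ?(gt_eqF s0)// !mul1r.
  by rewrite -scalerDr.
have pZ1 t x : 0 < t -> p (t *: x) <= t * p x.
  move=> t0; rewrite mulrC -ler_pdivrMr//; apply: (pge) => s s0 Ws.
  rewrite ler_pdivrMr//; apply: ple; first exact: mulr_gt0.
  by rewrite scalerA invfM -mulrA mulVf ?gt_eqF// mulr1.
have pp0 : p 0 = 0.
  apply/eqP; rewrite eq_le p0 andbT; apply/ler_addgt0Pr => e e0.
  by rewrite add0r; apply: ple => //; rewrite scaler0.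
have pZ t x : 0 <= t -> p (t *: x) = t * p x.
  rewrite le_eqVlt => /predU1P[<-|t0]; first by rewrite scale0r mul0r.
  apply/eqP; rewrite eq_le pZ1//=.
  have := pZ1 t^-1 (t *: x); rewrite invr_gt0 t0 scalerA mulVf ?gt_eqF// scale1r.
  by move=> /(_ isT); rewrite mulrC ler_pdivlMr// mulrC.
have pN x : p (- x) = p x.
  by congr inf; apply/seteqP; split => t [t0 /W'N Wt]; split => //;
    move: Wt; rewrite scalerN ?opprK.
exists p; first split => //.
- apply: filterS W'0 => x Wx /=; apply: ple => //.
  by rewrite invr1 scale1r.
- move=> x px1; have [t [t0 Wt] tp] := @inf_adherent _ (E x) (1 - p x)
    (ltac:(by rewrite subr_gt0)) (conj (E0 x) (Elb x)).
  have t1 : t < 1 by move: tp; rewrite -/(p x); lra.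
  apply: WV; have [+ _] : W' x; last by [].
  have := vW' _ _ t (1 - t) Wt W'1 (ltW t0).
  rewrite subr_ge0 (ltW t1) scaler0 addr0 scalerA divff ?gt_eqF// scale1r.
  by apply => //; rewrite addrC subrK.
Qed.

Lemma dual_of_linear p (g : X -> R^o) : cseminorm p -> linear g ->
  (forall x, g x <= p x) -> exists y : dual X, forall x, y x = g x.
Proof.
move=> cp lg gp; have [_ pN _] := cp.
have gB x z : g x - g z = g (x - z).
  by have := lg (-1) z x; rewrite !scaleN1r [- z + x]addrC => ->; rewrite addrC.
have gN x : g (- x) = - g x.
  by have := gB 0 x; rewrite sub0r -(subrr 0) -gB subrr sub0r => <-.
have cg : continuous g.
  move=> x; apply/(@cvgrPdist_le _ R^o) => e e0.
  apply: filterS (cseminorm_nbhs x cp e0) => z /= pz.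
  rewrite gB ler_norml; apply/andP; split.
    by rewrite -opprB gN lerN2; exact: le_trans (gp _) _.
  by apply: le_trans (gp _) _; rewrite -opprB pN.
have gP : g \in continuous_linear (X := X) by apply/asboolP.
by exists (Dual gP).
Qed.

Lemma dual_cseminorm (y : dual X) : cseminorm (fun x => `|y x : R|).
Proof.
split.
- split=> [a b|t a t0]; first by rewrite linearD; exact: ler_normD.
  by rewrite linearZ normrM ger0_norm.
- by move=> x; rewrite linearN normrN.
- have := @dual_continuous _ _ y 0; rewrite /continuous_at linear0.
  move=> /(@cvgrPdist_le _ R^o)/(_ 1 ltr01).
  by apply: filterS => x /=; rewrite sub0r normrN.
Qed.

Lemma cseminorm_dual p x : cseminorm p ->
  exists y : dual X, (forall z, y z <= p z :> R) /\ y x = p x.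
Proof.
move=> cp; have [sp pN _] := cp.
have [|||g [lg gp gx]] := @mazur_orlicz _ _ p [set x] (p x) sp.
- by exists x.
- by move=> _ _ s t -> -> _ _ st; rewrite -scalerDl st scale1r.
- by move=> _ ->.
have [y yg] := dual_of_linear cp lg gp.
exists y; split=> [z|]; first by rewrite yg.
by rewrite yg; apply/eqP; rewrite eq_le gp gx.
Qed.

(** Some open gauge ball around [x] misses [C], so the gauge is at least 1 on [C - x] and
    Mazur-Orlicz applies with [a = 1]. *)
Lemma dual_separation C x : segment_convex C -> closed C -> ~ C x ->
  exists (y : dual X) (e : R), 0 < e /\ forall c, C c -> y c >= (y x : R) + e.
Proof.
move=> vC clC Cx.
have [[c0 Cc0]|C0] := pselect (C !=set0); last first.
  by exists 0, 1; split => // c Cc; case: C0; exists c.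
have oC : nbhs x (~` C) by apply: open_nbhs_nbhs; split => //; exact: closed_openC.
have V0 : nbhs (0 : X) [set z | ~ C (z + x)].
  have := nbhsB (- x) oC; rewrite addNr; apply: filterS => _ [z nCz <-] /=.
  by rewrite addrAC addNr add0r.
have [p cp pV] := nbhs0_cseminorm V0; have [sp pN _] := cp.
have [|||g [lg gp gC]] := @mazur_orlicz _ _ p [set c - x | c in C] 1 sp.
- by exists (c0 - x), c0.
- move=> _ _ s t [c Cc <-] [d Cd <-] s0 t0 st.
  exists (s *: c + t *: d); first exact: vC.
  by rewrite !scalerBr addrACA -opprD -scalerDl st scale1r.
- move=> _ [c Cc <-]; rewrite leNgt; apply/negP => /pV /=.
  by rewrite subrK.
have [y yg] := dual_of_linear cp lg gp.
exists y, 1; split => // c Cc.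
have := gC (c - x); rewrite -yg linearB => /(_ (imageP _ Cc)).
by rewrite lerBrDl.
Qed.

End seminorms.

(** * Limits and series in the dual *)

Section dual_limits.
Context {R : realType} {X : tvsType R}.
Implicit Types (p : X -> R) (x : X) (y : dual X).

Lemma dual_sum (I : Type) (r : seq I) (P : pred I) (w : I -> dual X) x :
  (\sum_(i <- r | P i) w i) x = \sum_(i <- r | P i) (w i x : R).
Proof. by apply: (@big_morph _ _ (fun y : dual X => y x : R)). Qed.

Lemma dual_normr_le p y x : cseminorm p -> (forall z, y z <= p z :> R) ->
  `|y x : R| <= p x.
Proof.
move=> [_ pN _] yp; rewrite ler_norml yp andbT lerNl.
by have := yp (- x); rewrite pN linearN.
Qed.

Lemma cvg_le_bound (I : Type) (F : set_system I) (u : I -> R^o) (l c : R) :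
  ProperFilter F -> u i @[i --> F] --> (l : R^o) -> F [set i | u i <= c] -> l <= c.
Proof.
move=> FF ul uc.
exact: (@closed_cvg _ R^o F FF u _ (@closed_le R c) uc _ ul).
Qed.

(** Equicontinuity does the work: a pointwise limit of functionals below [p] stays below [p] and is
    therefore continuous. *)
Lemma dual_lim p (I : Type) (F : set_system I) (w : I -> dual X) (g : X -> R^o) :
    cseminorm p -> ProperFilter F -> (forall i x, w i x <= p x :> R) ->
    (forall x, (w i x : R^o) @[i --> F] --> g x) ->
  exists y : dual X, (forall x, y x <= p x :> R) /\ (forall x, y x = g x).
Proof.
move=> cp FF wp wg.
have gp x : g x <= p x.
  by apply: (cvg_le_bound FF (wg x)); apply: nearW => i; exact: wp.
have lg : linear g.
  move=> a x z.
  have h : (w i (a *: x + z) : R^o) @[i --> F] --> a *: g x + g z.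
    have -> : (fun i => w i (a *: x + z) : R^o) =
        (fun i => a *: (w i x : R^o) + w i z).
      by apply/funext => i; rewrite linearP.
    by apply: (@cvgD _ R^o); [apply: cvgZl_tmp|]; exact: wg.
  exact: (cvg_unique _ (wg _) h).
have [y yg] := dual_of_linear cp lg gp.
by exists y; split => x; rewrite yg.
Qed.

(** The partial sums stay below [(1 - q)^-1 * p], so their pointwise limit is continuous by
    [dual_lim]. *)
Lemma dual_geometric_series p (w : nat -> dual X) (q : R) :
    cseminorm p -> (forall i x, w i x <= p x :> R) -> 0 < q < 1 ->
  exists y : dual X, forall n x,
    `|(y x : R) - \sum_(i < n) q ^+ i * w i x| <= q ^+ n / (1 - q) * p x.
Proof.
move=> cp wp /andP[q0 q1].
have q1' : 0 < 1 - q by rewrite subr_gt0.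
pose S n x : R^o := \sum_(i < n) q ^+ i * (w i x : R).
have Sd n m x : `|S (n + m)%N x - S n x| <= q ^+ n / (1 - q) * p x.
  (* The factor [1 - q ^+ m] is what lets the induction on [m] close. *)
  suff : `|S (n + m)%N x - S n x| <= q ^+ n * (1 - q ^+ m) / (1 - q) * p x.
    move/le_trans; apply; rewrite ler_wpM2r ?cseminorm_ge0//.
    rewrite ler_pM2r ?invr_gt0// ger_pMr ?exprn_gt0//.
    by rewrite gerBl exprn_ge0// ltW.
  elim: m => [|m IH].
    by rewrite addn0 subrr normr0 expr0 subrr mulr0 !mul0r.
  rewrite addnS /S big_ord_recr /= addrAC.
  apply: le_trans (ler_normD _ _) _.
  have h : `|q ^+ (n + m) * (w (n + m)%N x : R)| <= q ^+ (n + m) * p x.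
    rewrite normrM gtr0_norm ?exprn_gt0// ler_pM2l ?exprn_gt0//.
    exact: dual_normr_le.
  apply: le_trans (lerD IH h) _; rewrite le_eqVlt; apply/orP; left; apply/eqP.
  by rewrite exprD exprS; field; rewrite gt_eqF.
have cS x : cvgn (S ^~ x).
  have -> : S ^~ x = series (fun i => q ^+ i * (w i x : R)).
    by apply/funext => n; rewrite /S seriesEord.
  apply: normed_cvg; apply: (@series_le_cvg _ _ (geometric (p x) q)).
  - by move=> n; exact: normr_ge0.
  - by move=> n; apply: mulr_ge0; [exact: cseminorm_ge0|exact/exprn_ge0/ltW].
  - move=> n /=; rewrite normrM gtr0_norm ?exprn_gt0// mulrC.
    rewrite ler_pM2r ?exprn_gt0//; exact: dual_normr_le.
  - by apply: is_cvg_geometric_series; rewrite gtr0_norm.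
pose g x : R^o := limn (S ^~ x).
have Sg n x : `|g x - S n x| <= q ^+ n / (1 - q) * p x.
  have h : `|S (n + m)%N x - S n x| @[m --> \oo] --> (`|g x - S n x| : R^o).
    apply: (@cvg_norm _ R^o); apply: (@cvgB _ R^o); last exact: cvg_cst.
    have -> : (fun m => S (n + m)%N x) = (fun m => S (m + n)%N x).
      by apply/funext => m; rewrite addnC.
    by rewrite (cvg_shiftn n (S ^~ x)); exact: cS.
  by apply: (@cvg_le_bound nat \oo _ _ _ _ h); exists 0%N => // m _ /=; exact: Sd.
pose W n : dual X := \sum_(i < n) q ^+ i *: w i.
have WE n x : W n x = S n x by rewrite dual_sum.
have cp' : cseminorm (fun x => (1 - q)^-1 * p x).
  by apply: cseminorm_scale; rewrite ?invr_gt0.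
have [|x|y [yp yg]] := @dual_lim _ _ \oo W g cp' _.
- move=> n x; rewrite WE; apply: le_trans (ler_norm _) _.
  by have := Sd 0 n x; rewrite /S big_ord0 subr0 expr0 mul1r.
- have -> : (fun n => W n x : R^o) = S ^~ x by apply/funext => n; rewrite WE.
  exact: cS.
by exists y => n x; rewrite yg; exact: Sg.
Qed.

(** A gliding hump. At [a n] the [n]-th term of the series [Y] has size
    [4^-1 ^+ n * p (a n) > n.+1], and the later terms add up to at most a third of it, so [Y] is
    unbounded on [A]. *)
Lemma dual_uniform_bound p (A : set X) : cseminorm p ->
    (forall y : dual X, exists M : R, forall a, A a -> `|y a : R| <= M) ->
  exists M : R, forall a, A a -> p a <= M.
Proof.
move=> cp Ab; apply: contrapT => /forallNP nM.
have /choice[a aP] : forall n : nat, exists a, A a /\ n.+1%:R * 4 ^+ n < p a.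
  move=> n; have /existsNP[a /not_implyP[Aa /negP]] := nM (n.+1%:R * 4 ^+ n).
  by rewrite -ltNge => h; exists a.
have /choice[y yP] : forall n, exists y : dual X,
    (forall z, y z <= p z :> R) /\ y (a n) = p (a n).
  by move=> n; exact: cseminorm_dual.
have [_ pN _] := cp.
pose z (S : dual X) n := if 0 <= (S (a n) : R) then y n else - y n.
pose S := fix S n := if n is m.+1 then S m + 4^-1 ^+ m *: z (S m) m else 0.
have zp n x : z (S n) n x <= p x :> R.
  rewrite /z; case: ifP => _; first by case: (yP n).
  by have [/(_ (- x)) + _] := yP n; rewrite pN linearN.
have SE n x : S n x = \sum_(i < n) 4^-1 ^+ i * z (S i) i x.
  elim: n => [|n IH]; first by rewrite big_ord0.
  by rewrite big_ord_recr /= -IH.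
have [|Y YP] := @dual_geometric_series p (fun n => z (S n) n) 4^-1 cp zp.
  lra.
have [M YM] := Ab Y.
have [n nM'] : exists n : nat, 2 * M < n%:R.
  by exists (Num.truncn (2 * M)).+1; exact: truncnS_gt.
have [An pn] := aP n.
have q0 : 0 < 4 ^-1 ^+ n :> R by rewrite exprn_gt0// invr_gt0.
have Sn : 4^-1 ^+ n * p (a n) <= `|S n.+1 (a n) : R|.
  have -> : (S n.+1 (a n) : R) = S n (a n) + 4^-1 ^+ n * z (S n) n (a n) by [].
  rewrite /z; have [_ yE] := yP n; case: ifPn => [s0|]; last rewrite -ltNge => s0.
    rewrite yE ger0_norm ?lerDr// addr_ge0// mulr_ge0 ?(ltW q0)//.
    exact: cseminorm_ge0.
  have -> : ((- y n) (a n) : R) = - p (a n) by rewrite -yE.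
  have p0 : 0 <= 4^-1 ^+ n * p (a n) by rewrite mulr_ge0 ?(ltW q0) ?cseminorm_ge0.
  by rewrite mulrN ltr0_norm; lra.
have := YP n.+1 (a n); rewrite -SE.
have := YM _ An.
have : n.+1%:R < 4^-1 ^+ n * p (a n).
  by rewrite exprVn mulrC ltr_pdivlMr// exprn_gt0.
rewrite exprS -natr1; move: Sn; move: (Y _ : R) (S _ _ : R) (4^-1 ^+ n) => u v w.
move=> h1 h2 h3 h4.
have h5 := ler_normB u (u - v).
have h6 : `|v| <= `|u| + `|u - v| by move: h5; rewrite opprB addrCA subrr addr0.
have h7 : 4^-1 * w / (1 - 4^-1) * p (a n) = (w * p (a n)) / 3 by field.
rewrite h7 in h4; have := normr_ge0 u; lra.
Qed.

(** A finite form of Helly's theorem, by induction on [s]: the condition [y x1 = 0] is dropped at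
    the price of replacing [phi] by [phi y - c * y x1], and the multiples collected make up [x]. *)
Lemma dual_helly p (phi : dual X -> R^o) (theta : R) (s : seq X) :
    cseminorm p -> linear phi ->
    (forall y, (forall x, y x <= p x :> R) -> (forall x, x \in s -> y x = 0) ->
      phi y <= theta) ->
  exists x, forall y, (forall z, y z <= p z :> R) -> phi y - y x <= theta.
Proof.
move=> cp; have [_ pN _] := cp.
elim: s phi => [|x1 s IH] phi lphi h.
  by exists 0 => y yp; rewrite linear0 subr0; exact: h.
pose N y := (forall x, y x <= p x :> R) /\ (forall x, x \in s -> y x = 0).
have NN y : N y -> N (- y).
  move=> [yp ys]; split=> x.
    by have := yp (- x); rewrite pN linearN.
  by move=> /ys; change ((- y) x) with (- (y x)) => ->; rewrite oppr0.
have phiN y : phi (- y) = - phi y.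
  have := lphi (-1) y 0; rewrite !scaleN1r !addr0 => ->.
  by have := lphi (-1) 0 0; rewrite !scaleN1r !addr0 oppr0; lra.
have phi0 : phi 0 = 0 by have := phiN 0; rewrite oppr0; lra.
(* The convex combination of [y] and [z] that vanishes at [x1] satisfies the hypothesis [h]. Hence
   every lower bound imposed on [c] is below every upper bound. *)
have key y z : N y -> N z -> 0 < (y x1 : R) -> z x1 < 0 :> R ->
    (phi y - theta) / y x1 <= (theta - phi z) / - z x1.
  move=> [yp ys] [zp zs]; set a := (y x1 : R); set b := (z x1 : R) => a0 b0.
  have ab : 0 < a - b by lra.
  have := h ((- b / (a - b)) *: y + (a / (a - b)) *: z).
  have -> : phi ((- b / (a - b)) *: y + (a / (a - b)) *: z) =
      (- b / (a - b)) * phi y + (a / (a - b)) * phi z.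
    rewrite lphi; congr (_ + _).
    by have := lphi (a / (a - b)) z 0; rewrite !addr0 => ->; rewrite phi0 addr0.
  have hp (x : X) : (- b / (a - b) * y x + (a / (a - b)) * z x : R) <= p x.
    have b1 : 0 <= - b / (a - b) by rewrite divr_ge0; lra.
    have a1 : 0 <= a / (a - b) by rewrite divr_ge0; lra.
    have h1 := ler_wpM2l b1 (yp x); have h2 := ler_wpM2l a1 (zp x).
    apply: le_trans (lerD h1 h2) _; rewrite -mulrDl -mulrDl addrC divff ?mul1r//.
    by rewrite gt_eqF.
  move=> /(_ hp) h1.
  have : - b / (a - b) * phi y + a / (a - b) * phi z <= theta.
    apply: h1 => x; rewrite inE => /predU1P[->|xs].
      change ((- b / (a - b)) * a + (a / (a - b)) * b = 0).
      by field; rewrite gt_eqF.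
    change ((- b / (a - b)) * (y x : R) + (a / (a - b)) * (z x : R) = 0).
    by rewrite ys// zs// !mulr0 addr0.
  have -> : - b / (a - b) * phi y + a / (a - b) * phi z =
    (- b * phi y + a * phi z) / (a - b) by field; rewrite gt_eqF.
  rewrite ler_pdivrMr// => h2.
  rewrite ler_pdivrMr// mulrAC ler_pdivlMr; last by rewrite oppr_gt0.
  by lra.
(* These are the lower bounds imposed on [c] by functionals positive at [x1]. Passing to [- y] shows
   below that [E] is nonempty or bounded, as needed. *)
pose E := [set r | exists y, [/\ N y, 0 < (y x1 : R) & r = (phi y - theta) / y x1]].
pose c := sup E.
have hc y : N y -> phi y - c * (y x1 : R) <= theta.
  move=> Ny; have yp := Ny.1; have ys := Ny.2.
  have [y0|y0|y0] := ltgtP (y x1 : R) 0.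
  - have y0' : 0 < - (y x1 : R) by rewrite oppr_gt0.
    have : c <= (theta - phi y) / - y x1.
      apply: ge_sup => [|_ [z [Nz z0 ->]]]; last exact: key.
      by exists ((phi (- y) - theta) / (- y) x1), (- y); split => //; exact: NN.
    by rewrite ler_pdivlMr//; lra.
  - have : (phi y - theta) / y x1 <= c.
      apply: ub_le_sup; last by exists y.
      have yN : (- y) x1 < 0 :> R by change (- (y x1 : R) < 0); rewrite oppr_lt0.
      exists ((theta - phi (- y)) / - (- y) x1) => _ [z [Nz z0 ->]].
      exact: (key _ _ Nz (NN _ Ny)).
    by rewrite ler_pdivrMr//; lra.
  - rewrite y0 mulr0 subr0; apply: h => // x; rewrite inE => /predU1P[->//|].
    exact: ys.
have [||x xP] := IH (fun y => phi y - c * (y x1 : R)).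
- move=> t y z; rewrite lphi.
  change (t * phi y + phi z - c * (t * (y x1 : R) + (z x1 : R)) =
    t * (phi y - c * (y x1 : R)) + (phi z - c * (z x1 : R))).
  by ring.
- by move=> y yp ys; exact: hc.
exists (c *: x1 + x) => y yp; rewrite linearD linearZ.
have := xP _ yp.
change (phi y - c * (y x1 : R) - (y x : R) <= theta ->
  phi y - (c * (y x1 : R) + (y x : R)) <= theta).
by lra.
Qed.

End dual_limits.

(** * Pryce's subsequence argument *)

Section upper_lower_limits.
Context {R : realType}.
Implicit Types (z w : nat -> R).

(** The limit superior and, by change of sign, the limit inferior of a bounded sequence. *)
Definition uplim z : R := inf [set t | \forall k \near \oo, z k <= t].
Definition lolim z : R := - uplim (fun k => - z k).

Definition seq_bounded z : Prop := exists M : R, forall k, `|z k| <= M.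

Lemma seq_boundedN z : seq_bounded z -> seq_bounded (fun k => - z k).
Proof. by move=> [M zM]; exists M => k; rewrite normrN. Qed.

Lemma uplim_set_inf z : seq_bounded z ->
  has_inf [set t | \forall k \near \oo, z k <= t].
Proof.
move=> [M zM]; split.
  by exists M; apply: nearW => k; exact: le_trans (ler_norm _) _.
exists (- M) => t [n _ nt].
apply: le_trans (nt n (leqnn n)).
by have := zM n; rewrite ler_norml => /andP[].
Qed.

Lemma uplim_le z t : seq_bounded z -> (\forall k \near \oo, z k <= t) ->
  uplim z <= t.
Proof. by move=> /uplim_set_inf[_ hz] zt; apply: ge_inf. Qed.

Lemma uplim_near z (e : R) : seq_bounded z -> 0 < e ->
  \forall k \near \oo, z k <= uplim z + e.
Proof.
move=> bz e0; have [t zt te] := inf_adherent e0 (uplim_set_inf bz).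
by apply: filterS zt => k; move/le_trans; apply; exact: ltW.
Qed.

Lemma lolim_ge z t : seq_bounded z -> (\forall k \near \oo, t <= z k) ->
  t <= lolim z.
Proof.
move=> /seq_boundedN bz zt; rewrite lerNr; apply: uplim_le => //.
by apply: filterS zt => k; rewrite lerN2.
Qed.

Lemma lolim_near z (e : R) : seq_bounded z -> 0 < e ->
  \forall k \near \oo, lolim z - e <= z k.
Proof.
move=> /seq_boundedN bz e0; apply: filterS (uplim_near bz e0) => k.
by rewrite /lolim; lra.
Qed.

End upper_lower_limits.

Section pryce.
Context {R : realType} {T : Type} (A : set T) (y : nat -> T -> R) (M : R).
Hypothesis A0 : A !=set0.
Hypothesis yM : forall k a, A a -> `|y k a| <= M.

Definition infinite_in (N : set nat) := forall n, exists2 k, (n <= k)%N & N k.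

(* Along [N] the infimum limit and the supremum limit of [y] give the same
   supremum of [u - b y] over [A], up to [e]. *)
Definition balanced (u : T -> R) (b e : R) (N : set nat) :=
  exists a c, [/\ A a, (\forall k \near \oo, N k -> y k a <= c) &
    forall a', A a' -> exists2 c', (\forall k \near \oo, N k -> c' <= y k a') &
      u a' - b * c' - e <= u a - b * c].

(** Only eventual bounds occur in [balanced], so it passes to subsets up to finitely many indices,
    as diagonalisation requires. *)
Lemma balanced_sub u b e (N N' : set nat) : balanced u b e N ->
  (\forall k \near \oo, N' k -> N k) -> balanced u b e N'.
Proof.
move=> [a [c [Aa ac h]]] NN'; exists a, c; split => //.
  by apply: filterS2 ac NN' => k + h1 /h1 => /[apply].
move=> a' /h[c' c'P h']; exists c' => //.
by apply: filterS2 c'P NN' => k + h1 /h1 => /[apply].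
Qed.

(** Let [l a] be the limit inferior along [N], and let [a] almost maximise [u - b * l]. Keeping the
    indices where [y k a] is close to [l a] brings the limit superior at [a] down to [l a], while
    limits inferior elsewhere can only grow. *)
Lemma balanced_dense u b e N : (exists Mu : R, forall a, A a -> `|u a| <= Mu) ->
  0 <= b -> 0 < e -> infinite_in N ->
  exists N', [/\ N' `<=` N, infinite_in N' & balanced u b e N'].
Proof.
move=> [Mu uM] b0 e0 infN.
pose E a := [set t : R | \forall k \near \oo, N k -> t <= y k a].
have E0 a : A a -> E a (- M).
  move=> Aa; exists 0%N => // k _ _.
  by have := yM k Aa; rewrite ler_norml => /andP[].
have EM a t : A a -> E a t -> t <= M.
  move=> Aa [n _ nt]; have [k nk Nk] := infN n.
  by apply: le_trans (nt k nk Nk) _; apply: le_trans (ler_norm _) (yM k Aa).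
have hE a : A a -> has_sup (E a).
  by move=> Aa; split; [exists (- M); exact: E0|exists M => t; exact: EM].
pose l a := sup (E a).
have lM a : A a -> `|l a| <= M.
  move=> Aa; rewrite ler_norml; apply/andP; split.
    by apply: ub_le_sup; [exact: (hE _ Aa).2|exact: E0].
  by apply: ge_sup; [exists (- M); exact: E0|move=> t; exact: EM].
(* Three errors of at most [e / 4] occur: one from the choice of [a], and [b * d] twice. The summand
   1 covers [b = 0]. *)
pose d := e / (4 * (b + 1)).
have d0 : 0 < d by rewrite divr_gt0 ?mulr_gt0//; lra.
have bd : b * d <= e / 4.
  rewrite /d mulrA ler_pdivrMr ?mulr_gt0//; last by lra.
  have -> : e / 4 * (4 * (b + 1)) = b * e + e by field.
  by lra.
pose S := [set u a - b * l a | a in A].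
have hS : has_sup S.
  split; first by have [a Aa] := A0; exists (u a - b * l a), a.
  exists (Mu + b * M) => _ [a Aa <-].
  have := uM _ Aa; have := lM _ Aa; rewrite !ler_norml => /andP[h1 _] /andP[_ h2].
  by have := ler_wpM2l b0 h1; lra.
have [_ [a Aa <-] aS] := sup_adherent (divr_gt0 e0 (ltr0n _ 4 : 0 < 4)) hS.
exists [set k | N k /\ y k a <= l a + d]; split.
- by move=> k [].
- move=> n; apply: contrapT => nk.
  have : E a (l a + d).
    exists n => // k nk' Nk; rewrite leNgt; apply/negP => /ltW yk.
    by apply: nk; exists k.
  by move=> /(ub_le_sup (hE _ Aa).2); rewrite -/(l a); lra.
- exists a, (l a + d); split => //; first by exists 0%N => // k _ [].
  move=> a' Aa'; exists (l a' - d).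
    have [t Et lt] := sup_adherent d0 (hE _ Aa').
    by apply: filterS Et => k + [Nk _] => /(_ Nk); apply: le_trans; exact: ltW.
  have : u a' - b * l a' <= sup S by apply: ub_le_sup; [exact: hS.2|exists a'].
  by rewrite mulrBr mulrDr; lra.
Qed.

(** Decreasing infinite sets [NN] meet the requirements one after the other. An increasing [s] with
    [s n] in [NN n] has its range almost contained in each of them. *)
Lemma diagonal_subsequence (P : nat -> set nat -> Prop) :
    (forall m N, infinite_in N ->
      exists N', [/\ N' `<=` N, infinite_in N' & P m N']) ->
    (forall m N N', P m N -> (\forall k \near \oo, N' k -> N k) -> P m N') ->
  exists s : nat -> nat, {homo s : i j / (i < j)%N} /\ forall m, P m (range s).
Proof.
move=> dP sP.
have /choice[next nextP] : forall mN : nat * set nat, exists N', infinite_in mN.2 ->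
    [/\ N' `<=` mN.2, infinite_in N' & P mN.1 N'].
  move=> [m N] /=; have [/(dP m)[N' ?]|nN] := pselect (infinite_in N).
    by exists N'.
  by exists set0.
pose NN := fix NN n := if n is m.+1 then next (m, NN m) else [set: nat].
have infNN n : infinite_in (NN n).
  elim: n => [|n IH]; first by move=> n; exists n.
  by have [] := nextP (n, NN n) IH.
have NNS n : NN n.+1 `<=` NN n by have [] := nextP (n, NN n) (infNN n).
have NNP n : P n (NN n.+1) by have [] := nextP (n, NN n) (infNN n).
have NNle m n : (m <= n)%N -> NN n `<=` NN m.
  move=> /subnK <-; elim: (n - m)%N => // k IH.
  by rewrite addSn; exact: subset_trans (NNS _) IH.
have /choice[pick pickP] : forall mn : nat * nat, exists k, (mn.2 <= k)%N /\ NN mn.1 k.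
  by move=> [m n] /=; have [k nk Nk] := infNN m n; exists k.
pose s := fix s n := if n is m.+1 then pick (m.+1, (s m).+1) else pick (0%N, 0%N).
have sN n : NN n (s n).
  by case: n => [|n]; [case: (pickP (0%N, 0%N))|case: (pickP (n.+1, (s n).+1))].
have sS : {homo s : i j / (i < j)%N}.
  apply: homo_ltn => [i j k|i]; first exact: ltn_trans.
  by case: (pickP (i.+1, (s i).+1)).
exists s; split => // m; apply: (sP _ _ _ (NNP m)).
exists (s m.+1) => // k /= mj [j _ sj]; rewrite -sj in mj *.
suff h : (m.+1 <= j)%N by exact: NNle h _ (sN j).
by rewrite leqNgt; apply/negP => /sS; rewrite ltnNge mj.
Qed.

Lemma pryce_subsequence (u : nat -> T -> R) (b : nat -> R) :
    (forall m, exists Mu : R, forall a, A a -> `|u m a| <= Mu) ->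
    (forall m, 0 <= b m) ->
  exists s : nat -> nat, {homo s : i j / (i < j)%N} /\
    forall m e, 0 < e -> exists2 a, A a & forall a', A a' ->
      u m a' - b m * lolim (fun k => y (s k) a') - e <=
      u m a - b m * uplim (fun k => y (s k) a).
Proof.
move=> uM b0.
(* One requirement for each [m] and each accuracy [1 / (j + 1)]; numbers that code no pair require
   nothing. *)
pose P n := if @unpickle (nat * nat)%type n is Some (m, j)
  then balanced (u m) (b m) j.+1%:R^-1 else fun=> True.
have [||s [sS sP]] := @diagonal_subsequence P.
- move=> m N infN; rewrite /P; case: unpickle => [[n j]|]; last by exists N; split.
  exact: balanced_dense.
- by move=> m N N'; rewrite /P; case: unpickle => [[n j]|//]; exact: balanced_sub.
exists s; split => // m e e0.
have [j je] : exists j : nat, j.+1%:R^-1 < e.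
  exists (Num.truncn e^-1).
  by rewrite -[ltRHS]invrK ltf_pV2 ?truncnS_gt// posrE ?invr_gt0 ?ltr0n.
have := sP (pickle (m, j)); rewrite /P pickleK => -[a [c [Aa ac h]]].
have sle k : (k <= s k)%N.
  by elim: k => // k /leq_ltn_trans; apply; exact: sS.
have sub (Q : nat -> Prop) : (\forall k \near \oo, range s k -> Q k) ->
    \forall k \near \oo, Q (s k).
  by move=> [n _ nQ]; exists n => // k nk; apply: nQ; [exact: leq_trans (sle k)|exists k].
have ybd a' : A a' -> seq_bounded (fun k => y (s k) a').
  by move=> Aa'; exists M => k; exact: yM.
exists a => // a' Aa'; have [c' c'P h'] := h _ Aa'.
have up := uplim_le (ybd _ Aa) (sub _ ac).
have lo := lolim_ge (ybd _ Aa') (sub _ c'P).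
have := ler_wpM2l (b0 m) up; have := ler_wpM2l (b0 m) lo.
by move: je h'; move: (j.+1%:R^-1) => r; lra.
Qed.

End pryce.

Lemma ultra_bounded_cvg {R : realType} {I : Type} (F : set_system I) (u : I -> R^o)
    (c : R) : UltraFilter F -> F [set i | `|u i : R| <= c] ->
  exists l : R^o, u i @[i --> F] --> l.
Proof.
move=> FU Fc.
have cK : compact (`[(- c)%R, c] : set R^o) by exact: segment_compact.
have FK : F (u @^-1` `[(- c)%R, c]).
  by apply: (filterS _ Fc) => i; rewrite /= ler_norml in_itv.
have [l [_ cl]] := cK (u @ F) (fmap_proper_filter _ _) FK.
exists l => V Vl; have [//|nV] := in_ultra_setVsetC (u @^-1` V) FU.
by have [r [/= ]] := cl (~` V) V nV Vl.
Qed.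

(** * James' iteration *)

Section suprema.
Context {R : realType} {T : Type} (A : set T).
Implicit Types (g h : T -> R).

Definition sup_on g : R := sup [set g a | a in A].

Definition bounded_on g : Prop := exists M : R, forall a, A a -> `|g a| <= M.

Lemma bounded_onD g h : bounded_on g -> bounded_on h -> bounded_on (g \+ h).
Proof.
move=> [M gM] [N hN]; exists (M + N) => a Aa /=.
by apply: le_trans (ler_normD _ _) (lerD (gM _ Aa) (hN _ Aa)).
Qed.

Lemma bounded_onZ (c : R) g : bounded_on g -> bounded_on (fun a => c * g a).
Proof.
move=> [M gM]; exists (`|c| * M) => a Aa.
by rewrite normrM ler_wpM2l//; exact: gM.
Qed.

Lemma sup_on_ub g a : bounded_on g -> A a -> g a <= sup_on g.
Proof.
move=> [M gM] Aa; apply: ub_le_sup; last by exists a.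
by exists M => _ [b Ab <-]; apply: le_trans (ler_norm _) (gM _ Ab).
Qed.

Lemma sup_on_le g (c : R) : A !=set0 -> (forall a, A a -> g a <= c) -> sup_on g <= c.
Proof.
move=> [a Aa] gc; apply: ge_sup; first by exists (g a), a.
by move=> _ [b Ab <-]; exact: gc.
Qed.

End suprema.

Section mixing_hull.
Context {R : realType} {X : tvsType R} (q : R).
Implicit Types (y : nat -> dual X) (w : dual X).

(** Replaces the convex hull of a tail of [y]. The iteration uses only this one mixing ratio, and
    finite terms over the [y k] form a countable family, as Pryce's argument demands. *)
Inductive mixhull y (n : nat) : dual X -> Prop :=
| Mixgen k : (n <= k)%N -> mixhull y n (y k)
| Mixmix w w' : mixhull y n w -> mixhull y n w' ->
    mixhull y n ((1 + q)^-1 *: (w + q *: w')).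

Lemma mixhull_le y m n w : (m <= n)%N -> mixhull y n w -> mixhull y m w.
Proof.
move=> mn; elim => [k nk|v v' _ IH _ IH']; first exact/Mixgen/(leq_trans mn).
exact: Mixmix.
Qed.

Lemma mix_apply w w' x :
  ((1 + q)^-1 *: (w + q *: w')) x = (1 + q)^-1 * ((w x : R) + q * w' x) :> R.
Proof. by []. Qed.

Hypothesis q0 : 0 < q.

Lemma mixhull_le_bound y n w x (c : R) :
  (forall k, (n <= k)%N -> y k x <= c :> R) -> mixhull y n w -> w x <= c :> R.
Proof.
move=> yc; elim => [k /yc//|v v' _ IH _ IH'].
rewrite mix_apply mulrC ler_pdivrMr; last by rewrite addr_gt0.
by have := ler_wpM2l (ltW q0) IH'; lra.
Qed.

Lemma mixhull_ge_bound y n w x (c : R) :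
  (forall k, (n <= k)%N -> c <= y k x :> R) -> mixhull y n w -> c <= w x :> R.
Proof.
move=> yc; elim => [k /yc//|v v' _ IH _ IH'].
rewrite mix_apply mulrC ler_pdivlMr; last by rewrite addr_gt0.
by have := ler_wpM2l (ltW q0) IH'; lra.
Qed.

Lemma mixhull_eventually_ge y n w (x : nat -> X) (c : R) :
    (forall k j, (k <= j)%N -> c <= y k (x j) :> R) -> mixhull y n w ->
  exists j0, forall j, (j0 <= j)%N -> c <= w (x j) :> R.
Proof.
move=> yc; elim => [k _|v v' _ [j1 IH] _ [j2 IH']].
  by exists k => j; exact: yc.
exists (maxn j1 j2) => j; rewrite geq_max => /andP[/IH h1 /IH' h2].
rewrite mix_apply mulrC ler_pdivlMr; last by rewrite addr_gt0.
by have := ler_wpM2l (ltW q0) h2; lra.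
Qed.

(** Evaluates terms of a countable type; nodes that are not binary get the default value 0. *)
Fixpoint mix_eval y (t : GenTree.tree nat) : dual X :=
  match t with
  | GenTree.Leaf k => y k
  | GenTree.Node _ [:: a; b] => (1 + q)^-1 *: (mix_eval y a + q *: mix_eval y b)
  | _ => 0
  end.

(** The tree refers to [y] itself rather than to [y \o s], so the countable family can be fixed
    before the subsequence is chosen. *)
Lemma mixhull_eval y (s : nat -> nat) n w : mixhull (y \o s) n w ->
  exists t, w = mix_eval y t.
Proof.
elim => [k _|v v' _ [t ->] _ [t' ->]]; first by exists (GenTree.Leaf (s k)).
by exists (GenTree.Node 0 [:: t; t']).
Qed.

End mixing_hull.

Section james_iteration.
Context {R : realType} {X : tvsType R} (A : set X) (y : nat -> dual X) (M : R).
Context (Lam : X -> R) (q theta : R).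
Hypothesis A0 : A !=set0.
Hypothesis yM : forall k a, A a -> `|y k a : R| <= M.
Hypothesis LamM : forall a, A a -> `|Lam a| <= M.
Hypothesis q0 : 0 < q.
Hypothesis theta0 : 0 < theta.
Hypothesis base : forall w, mixhull q y 0 w ->
  theta <= sup_on A (fun x => (w x : R) - Lam x).

Let dif (w : dual X) (x : X) : R := w x - Lam x.

Lemma bounded_on_dif n w : mixhull q y n w -> bounded_on A (dif w).
Proof.
move=> hw; exists (M + M) => a Aa; apply: le_trans (ler_normB _ _) _.
apply: lerD; last exact: LamM.
rewrite ler_norml; apply/andP; split.
  apply: (mixhull_ge_bound q0 _ hw) => k _.
  by have := yM k Aa; rewrite ler_norml => /andP[].
apply: (mixhull_le_bound q0 _ hw) => k _.
by have := yM k Aa; rewrite ler_norml => /andP[].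
Qed.

(** The invariant of the iteration: with [v] the sum of the first [n] terms, every admissible next
    term raises the supremum by at least [q ^+ n * alpha]. *)
Let inv (n : nat) (v : X -> R) (alpha : R) : Prop :=
  bounded_on A v /\ forall z, mixhull q y n z ->
    sup_on A v + q ^+ n * alpha <= sup_on A (fun x => v x + q ^+ n * dif z x).

(* The convex combination of [v] and [v + q^n dif w + q^(n+1) dif z] with
   weights [q/(1+q)] and [1/(1+q)] is [v + q^n dif (w mixed with z)]. *)
Lemma james_iteration_step n v (alpha alpha' : R) : alpha' < alpha ->
    inv n v alpha ->
  exists2 w, mixhull q y n w & inv n.+1 (fun x => v x + q ^+ n * dif w x) alpha'.
Proof.
move=> aa [bv hv].
pose E := [set r | exists2 z, mixhull q y n z &
  r = sup_on A (fun x => v x + q ^+ n * dif z x)].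
have E0 : E !=set0.
  by eexists; exists (y n); [exact: Mixgen|reflexivity].
have hE : has_inf E.
  by split => //; exists (sup_on A v + q ^+ n * alpha) => _ [z hz ->]; exact: hv.
have qn0 : 0 < q ^+ n by rewrite exprn_gt0.
(* [w] minimises the next supremum up to this tolerance, which is exactly what is lost when [alpha]
   drops to [alpha'] at level [n.+1]. *)
have d0 : 0 < q ^+ n.+1 * (alpha - alpha').
  by rewrite mulr_gt0 ?exprn_gt0// subr_gt0.
have [_ [w hw ->] wE] := inf_adherent d0 hE.
have bw : bounded_on A (fun x => v x + q ^+ n * dif w x).
  by apply: bounded_onD => //; apply: bounded_onZ; exact: bounded_on_dif hw.
exists w => //; split => // z /(mixhull_le (leqnSn n)) hz.
set Z := sup_on A (fun x => _ + q ^+ n.+1 * _).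
have IE : inf E <= (1 + q)^-1 * (q * sup_on A v + Z).
  have hm := Mixmix hw hz.
  apply: (@le_trans _ _ (sup_on A (fun x => v x +
      q ^+ n * dif ((1 + q)^-1 *: (w + q *: z)) x))).
    by apply: ge_inf; [exact: hE.2|exists ((1 + q)^-1 *: (w + q *: z))].
  apply: sup_on_le => // a Aa.
  rewrite /dif mix_apply [leRHS]mulrC ler_pdivlMr ?addr_gt0//.
  have h1 := sup_on_ub bv Aa.
  have bz : bounded_on A (fun x => v x + q ^+ n * dif w x + q ^+ n.+1 * dif z x).
    by apply: bounded_onD => //; apply: bounded_onZ; exact: bounded_on_dif hz.
  have h2 := sup_on_ub bz Aa; rewrite -/Z /dif exprS in h2.
  have h3 := ler_wpM2l (ltW q0) h1.
  have -> : (v a + q ^+ n * ((1 + q)^-1 * ((w a : R) + q * z a) - Lam a)) * (1 + q) =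
    q * v a + (v a + q ^+ n * ((w a : R) - Lam a) + q * q ^+ n * ((z a : R) - Lam a)).
    by field; rewrite gt_eqF// addr_gt0.
  by apply: lerD.
have Iv : sup_on A v + q ^+ n * alpha <= inf E.
  by apply: lb_le_inf => // _ [z' hz' ->]; exact: hv.
move: IE; rewrite [leRHS]mulrC ler_pdivlMr ?addr_gt0// => IE.
have := ler_wpM2l (ltW q0) Iv; rewrite -/E in wE.
move: wE; rewrite exprS; move: IE.
by lra.
Qed.

Lemma james_iteration : exists w : nat -> dual X,
  (forall n, mixhull q y n (w n)) /\
  forall n, sup_on A (fun x => \sum_(i < n) q ^+ i * dif (w i) x) +
      q ^+ n * (theta / 2) <=
    sup_on A (fun x => \sum_(i < n.+1) q ^+ i * dif (w i) x).
Proof.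
(* Decreases strictly from [theta] towards [theta / 2], leaving every step something to lose. *)
pose al n : R := theta * (1 + 2^-1 ^+ n) / 2.
have alS n : al n.+1 < al n.
  rewrite /al ltr_pM2r ?invr_gt0// ltr_pM2l// ltrD2l exprS gtr_pMl ?exprn_gt0 ?invr_gt0//.
  by rewrite invf_lt1// ltr1n.
have alh n : theta / 2 <= al n.
  rewrite /al ler_pM2r ?invr_gt0// ler_pMr// lerDl exprn_ge0// invr_ge0//.
(* Where the invariant fails, [y n] is a default that keeps [W] total; along [V] the invariant
   always holds. *)
have /choice[W WP] : forall nv : nat * (X -> R), exists w, mixhull q y nv.1 w /\
    (inv nv.1 nv.2 (al nv.1) ->
     inv nv.1.+1 (fun x => nv.2 x + q ^+ nv.1 * dif w x) (al nv.1.+1)).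
  move=> [n v] /=; have [h|h] := pselect (inv n v (al n)).
    by have [w hw iw] := james_iteration_step (alS n) h; exists w.
  by exists (y n); split => //; exact: Mixgen.
pose V := fix V n : X -> R := if n is m.+1
  then (fun x => V m x + q ^+ m * dif (W (m, V m)) x) else (fun=> 0).
pose w n := W (n, V n).
have hw n : mixhull q y n (w n) by have [] := WP (n, V n).
have VE n : V n = fun x => \sum_(i < n) q ^+ i * dif (w i) x.
  elim: n => [|n IH]; apply/funext => x; first by rewrite big_ord0.
  by rewrite big_ord_recr /= -(congr1 (@^~ x) IH).
have iV n : inv n (V n) (al n).
  elim: n => [|n IH]; last by have [_ /(_ IH)] := WP (n, V n).
  split; first by exists 0 => a _; rewrite normr0.
  move=> z hz; rewrite /= expr0 mul1r /al expr0 mulfK//.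
  have -> : sup_on A (fun=> 0 : R) = 0.
    have [a Aa] := A0; rewrite -[RHS]sup1; congr sup.
    by apply/seteqP; split => [_ [b _ <-]//|_ ->]; exists a.
  rewrite add0r; under eq_fun do rewrite add0r mul1r; exact: base.
exists w; split => // n; rewrite -!VE.
have [_ /(_ _ (hw n))] := iV n; apply: le_trans; rewrite lerD2l ler_pM2l ?exprn_gt0//.
Qed.

End james_iteration.

(** * James' theorem *)

Section james.
Context {R : realType} {X : tvsType R} (A : set X).
Hypothesis attained : forall y : dual X,
  exists2 a, A a & forall a', A a' -> y a' <= y a :> R.

Lemma attained_nonempty : A !=set0.
Proof. by have [a Aa _] := attained 0; exists a. Qed.


Lemma attained_bounded (y : dual X) : exists M : R, forall a, A a -> `|y a : R| <= M.
Proof.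
have [a Aa ya] := attained y; have [b Ab yb] := attained (- y).
exists (`|y a : R| + `|y b : R|) => c Ac.
have h1 := ya _ Ac.
have h2 : - (y c : R) <= - (y b : R) by exact: (yb _ Ac).
have h3 := ler_norm (y a : R); have h4 := ler_norm (- (y b : R)).
rewrite normrN in h4; have h5 := normr_ge0 (y a : R); have h6 := normr_ge0 (y b : R).
by rewrite ler_norml; apply/andP; split; lra.
Qed.

Lemma uplim_normr_le (z : nat -> R) (M : R) : (forall k, `|z k| <= M) ->
  `|uplim z| <= M.
Proof.
move=> zM; have bz : seq_bounded z by exists M.
have zlo k : - M <= z k by have := zM k; rewrite ler_norml => /andP[].
rewrite ler_norml; apply/andP; split; last first.
  by apply: uplim_le => //; apply: nearW => k; apply: le_trans (ler_norm _) (zM k).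
apply/ler_addgt0Pr => e e0; have [n _ nP] := uplim_near bz e0.
exact: le_trans (zlo n) (nP n (leqnn n)).
Qed.

(** If [G], the sum of the [q ^+ i *: (w i - w0)], had a maximum on [A] at [a], then
    [w n a - w0 a >= al / 2] would hold for all [n], although [w0 a] is a limit of the [w n a]. *)
Lemma no_james_sequences p (y : nat -> dual X) (x : nat -> X) (theta : R) :
    cseminorm p -> (forall n z, y n z <= p z :> R) -> (forall n, A (x n)) ->
    (forall k n, (k < n)%N -> y n (x k) = 0) ->
    (forall n k, (n <= k)%N -> theta <= y n (x k) :> R) -> 0 < theta -> False.
Proof.
move=> cp yp Ax yx0 yxt theta0; have A0 := attained_nonempty.
have [_ pN _] := cp.
have [M0 M0P] := dual_uniform_bound cp attained_bounded.
pose M := Num.max M0 1.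
have M1 : 1 <= M by rewrite le_max lexx orbT.
have pM a : A a -> p a <= M by move=> Aa; rewrite le_max M0P.
have bM (w : dual X) a : (forall z, w z <= p z :> R) -> A a -> `|w a : R| <= M.
  by move=> wp Aa; apply: le_trans (dual_normr_le _ cp wp) (pM _ Aa).
pose al := theta / 2; have al0 : 0 < al by rewrite divr_gt0.
(* Gives [q / (1 - q) = al / (8 * M)]. A tail of [G] after [n.+1] terms is then at most
   [q ^+ n * (al / 4)] on [A], and two such tails cost half of the gain [q ^+ n * al]. *)
pose q := al / (al + 8 * M).
have aM0 : 0 < al + 8 * M by lra.
have q0 : 0 < q by rewrite divr_gt0.
have q1 : q < 1 by rewrite ltr_pdivrMr//; lra.
have q1' : 0 < 1 - q by rewrite subr_gt0.
have qE : q / (1 - q) = al / (8 * M).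
  by rewrite /q; field; rewrite ?gt_eqF//; lra.
have mixp (y' : nat -> dual X) n w : (forall n z, y' n z <= p z :> R) ->
    mixhull q y' n w -> forall z, w z <= p z :> R.
  by move=> y'p hw z; apply: (mixhull_le_bound q0 _ hw) => k _; exact: y'p.
(* The [w n] will depend on the subsequence, so Pryce's argument is run for all lists of terms at
   once; [bs] is the total weight of a list. *)
pose us (s : seq (GenTree.tree nat)) (z : X) : R :=
  \sum_(i < size s) q ^+ i * mix_eval q y (nth (GenTree.Leaf 0%N) s i) z.
pose bs (s : seq (GenTree.tree nat)) : R := \sum_(i < size s) q ^+ i.
pose U m := if unpickle m is Some s then us s else fun=> 0.
pose B m := if unpickle m is Some s then bs s else 0.
have [|||s [sS sP]] := @pryce_subsequence R X A (fun k => y k) M A0 _ U B.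
- by move=> k a Aa; exact: bM.
- move=> m; rewrite /U; case: unpickle => [l|]; last by exists 0 => a _; rewrite normr0.
  have [N NP] := attained_bounded
    (\sum_(i < size l) q ^+ i *: mix_eval q y (nth (GenTree.Leaf 0%N) l i)).
  by exists N => a /NP; rewrite dual_sum.
- move=> m; rewrite /B; case: unpickle => [l|//].
  by apply: sumr_ge0 => i _; rewrite exprn_ge0// ltW.
have sP' l e : 0 < e -> exists2 a, A a & forall a', A a' ->
    us l a' - bs l * lolim (fun k => y (s k) a') - e <=
    us l a - bs l * uplim (fun k => y (s k) a).
  by move=> /(sP (pickle l)); rewrite /U /B pickleK.
pose y' := y \o s; pose x' := x \o s.
have y'p k z : y' k z <= p z :> R by exact: yp.
pose Lam a := uplim (fun k => y' k a : R).
pose lam a := lolim (fun k => y' k a : R).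
have y'b a : seq_bounded (fun k => y' k a : R).
  by exists (p a) => k; exact: dual_normr_le.
have LamM a : A a -> `|Lam a| <= M.
  by move=> Aa; apply: uplim_normr_le => k; exact: bM.
have y'M k a : A a -> `|y' k a : R| <= M by exact: bM.
(* At [x' j0] with [j0] large, [w] is at least [theta], whereas the [y' k] vanish there for
   [k > j0], so that [Lam] is at most 0. *)
have base w : mixhull q y' 0 w -> theta <= sup_on A (fun z => (w z : R) - Lam z).
  move=> hw.
  have [|j0 /(_ _ (leqnn j0)) h] := @mixhull_eventually_ge _ _ _ q0 y' 0 w x' theta _ hw.
    move=> k j kj; apply: yxt; move: kj; rewrite leq_eqVlt => /predU1P[->//|/sS].
    exact: ltnW.
  apply: (@le_trans _ _ ((w (x' j0) : R) - Lam (x' j0))).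
    suff : Lam (x' j0) <= 0 by lra.
    apply: uplim_le => //; exists j0.+1 => // k /= jk.
    by rewrite /y' /= yx0//; exact: sS.
  have bw := bounded_on_dif y'M LamM q0 hw.
  exact: (sup_on_ub bw (Ax _)).
have [w [hw wS]] := james_iteration A0 y'M LamM q0 theta0 base.
have wp n z : w n z <= p z :> R by apply: mixp (hw n) z.
(* Along an ultrafilter the [w n] converge pointwise. As [w n] is made of [y' k] with [k >= n], the
   limit [w0] lies between [lam] and [Lam]. *)
have [F [FU FF]] := ultraFilterLemma (_ : ProperFilter \oo).
have /choice[g gP] z : exists l : R^o, (w n z : R^o) @[n --> F] --> l.
  apply: (@ultra_bounded_cvg R nat F (fun n => w n z) (p z)).
  by apply: FF; exists 0%N => // n _; exact: dual_normr_le.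
have [w0 [w0p w0g]] := dual_lim cp (@ultra_proper _ F FU) wp gP.
have w0Lam a : (w0 a : R) <= Lam a.
  apply/ler_addgt0Pr => e e0; rewrite w0g; apply: (cvg_le_bound _ (gP a)).
  have [n _ nP] := uplim_near (y'b a) e0.
  apply: FF; exists n => // m nm; apply: (mixhull_le_bound q0 _ (hw m)) => k mk.
  exact: nP (leq_trans nm mk).
have lamw0 a : lam a <= w0 a.
  apply/ler_addgt0Pr => e e0; rewrite -lerBlDr w0g -lerN2.
  apply: (@cvg_le_bound _ _ F (fun n => - (w n a : R)) (- g a)).
    by apply: (@cvgN _ R^o); exact: gP.
  have [n _ nP] := lolim_near (y'b a) e0.
  apply: FF; exists n => // m nm; rewrite /= lerN2.
  apply: (mixhull_ge_bound q0 _ (hw m)) => k mk.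
  exact: nP (leq_trans nm mk).
pose S n := sup_on A (fun z => \sum_(i < n) q ^+ i * ((w i z : R) - Lam z)).
have {}wS n : S n + q ^+ n * al <= S n.+1 by exact: wS.
pose b n : R := \sum_(i < n) q ^+ i.
have b0 n : 0 <= b n by apply: sumr_ge0 => i _; rewrite exprn_ge0// ltW.
have sumE n z r : \sum_(i < n) q ^+ i * ((w i z : R) - r) =
    \sum_(i < n) q ^+ i * (w i z : R) - b n * r.
  by rewrite mulr_suml -sumrB; apply: eq_bigr => i _; rewrite mulrBr.
have bS n : bounded_on A (fun z => \sum_(i < n) q ^+ i * ((w i z : R) - Lam z)).
  have [N NP] := attained_bounded (\sum_(i < n) q ^+ i *: w i).
  exists (N + b n * M) => a Aa; rewrite sumE.
  apply: le_trans (ler_normB _ _) _; apply: lerD.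
    by have := NP _ Aa; rewrite dual_sum.
  by rewrite normrM (ger0_norm (b0 n)) ler_wpM2l//; exact: LamM.
have /choice[t tE] : forall n, exists t, w n = mix_eval q y t.
  by move=> n; exact: mixhull_eval (hw n).
(* Pryce's subsequence enters here: replacing [Lam] by the smaller [lam] does not raise the supremum
   [S n]. *)
have gS n a : A a -> \sum_(i < n) q ^+ i * (w i a : R) - b n * lam a <= S n.
  move=> Aa; apply/ler_addgt0Pr => e e0.
  have [a1 Aa1 /(_ _ Aa)] := sP' (mkseq t n) e e0.
  have usE z : us (mkseq t n) z = \sum_(i < n) q ^+ i * (w i z : R).
    rewrite /us size_mkseq; apply: eq_bigr => i _.
    by rewrite nth_mkseq// -tE.
  have bsE : bs (mkseq t n) = b n by rewrite /bs size_mkseq.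
  rewrite !usE !bsE => h.
  have := sup_on_ub (bS n) Aa1; rewrite sumE -/(S n).
  by move: h; rewrite -/(Lam a1) -/(lam a); lra.
have cp2 : cseminorm (fun z => 2 * p z) by exact: cseminorm_scale.
have [||G GP] := @dual_geometric_series _ _ _ (fun i => w i - w0) q cp2.
- move=> i z; have h1 := wp i z; have := w0p (- z); rewrite pN linearN => h2.
  by change ((w i z : R) - w0 z <= 2 * p z); lra.
- by rewrite q0.
have [a Aa aG] := attained G.
have tail n c : A c -> `|(G c : R) - (\sum_(i < n) q ^+ i * (w i c : R) - b n * w0 c)| <=
    q ^+ n / (1 - q) * (2 * M).
  move=> Ac; have := GP n c; rewrite -sumE => /le_trans; apply.
  rewrite ler_pM2l ?divr_gt0 ?exprn_gt0// ler_pM2l//; exact: pM.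
(* Up to tails, [G a] is at least [S n.+1] by [w0 <= Lam], and at most
   [S n + q ^+ n * (w n a - w0 a)] by [gS] and [lam <= w0]. *)
have key n : al / 2 <= (w n a : R) - w0 a.
  have h1 : S n.+1 - q ^+ n.+1 / (1 - q) * (2 * M) <= G a.
    rewrite lerBlDr; apply: sup_on_le => // c Ac; rewrite sumE.
    have := tail n.+1 c Ac; rewrite ler_norml => /andP[h _].
    have := ler_wpM2l (b0 n.+1) (w0Lam c); have := aG _ Ac; lra.
  have := tail n.+1 a Aa; rewrite ler_norml => /andP[_ h2].
  have h3 := gS n a Aa; have h4 := ler_wpM2l (b0 n) (lamw0 a).
  rewrite /b !big_ord_recr /= -/(b n) in h2.
  have h5 := wS n.
  have qE' : q ^+ n.+1 / (1 - q) * (2 * M) = q ^+ n * (al / 4).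
    have -> : q ^+ n.+1 / (1 - q) * (2 * M) = q ^+ n * (q / (1 - q) * (2 * M)).
      by rewrite exprS; ring.
    by rewrite qE; congr (_ * _); field; lra.
  rewrite qE' in h1 h2.
  have h6 : q ^+ n * (al / 2) <= q ^+ n * ((w n a : R) - w0 a) by lra.
  by move: h6; rewrite ler_pM2l ?exprn_gt0.
have : - (w0 a : R) <= - (w0 a : R) - al / 2.
  rewrite {1}w0g; apply: (@cvg_le_bound _ _ F (fun n => - (w n a : R)) (- g a)).
    by apply: (@cvgN _ R^o); exact: gP.
  by apply: FF; exists 0%N => // n _ /=; have := key n; lra.
by lra.
Qed.

(** Otherwise two choices alternate: [Y] from Helly's theorem vanishes on the points found so far,
    and [Z] is a point of [A], found along [F], where all functionals found so far are at least [e].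
    No such sequences exist. *)
Lemma dual_limit_approx (F : set_system X) (phi : dual X -> R^o) p (e : R) :
    ProperFilter F -> F A -> linear phi ->
    (forall y : dual X, (y z : R^o) @[z --> F] --> phi y) ->
    cseminorm p -> 0 < e ->
  exists x, forall y : dual X, (forall z, y z <= p z :> R) ->
    phi y - y x <= e.
Proof.
move=> FF FA lphi Fphi cp e0; apply: contrapT => nx.
have /choice[Y YP] : forall s : seq X, exists y : dual X,
    [/\ forall z, y z <= p z :> R, forall x, x \in s -> y x = 0 & e < phi y].
  move=> s; apply: contrapT => nY; apply: nx.
  apply: (dual_helly (s := s) cp lphi) => y yp ys.
  by rewrite leNgt; apply/negP => ey; apply: nY; exists y.
have /choice[Z ZP] : forall l : seq (dual X), exists x,
    (forall y, y \in l -> e < phi y) -> A x /\ forall y, y \in l -> e <= y x :> R.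
  move=> l; have [lP|nlP] := pselect (forall y, y \in l -> e < phi y); last first.
    by exists 0.
  have : F [set x | A x /\ forall y, y \in l -> e <= y x :> R].
    elim: l lP => [|y l IH] lP.
      by apply: filterS FA => x.
    have {}IH := IH (fun z zl => lP z (mem_behead (s := y :: l) zl)).
    have : F [set z | e < y z :> R].
      have ey := lP y (mem_head _ _).
      have := Fphi y; move=> /(_ [set r : R^o | e < r]); apply.
      by apply: open_nbhs_nbhs; split => //; exact: open_gt.
    apply: filterS2 IH => x [Ax lx] ex; split => // z.
    by rewrite inE => /predU1P[->|/lx//]; exact: ltW.
  by move=> /filter_ex[x xP]; exists x.
(* The state lists the points and functionals already chosen. The point [x n] is chosen after [y n],
   hence [y n (x n) >= e]. *)
pose st := fix st n : seq X * seq (dual X) := if n is m.+1 then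
  let: (xs, ys) := st m in (Z (Y xs :: ys) :: xs, Y xs :: ys) else ([::], [::]).
pose y n := Y (st n).1; pose x n := Z (y n :: (st n).2).
have stS n : st n.+1 = (x n :: (st n).1, y n :: (st n).2).
  by rewrite /x /y /=; case: (st n).
have xs n k : (k < n)%N -> x k \in (st n).1.
  elim: n => // n IH; rewrite ltnS leq_eqVlt stS inE => /predU1P[->|/IH ->].
    by rewrite eqxx.
  by rewrite orbT.
have ys n k : (k < n)%N -> y k \in (st n).2.
  elim: n => // n IH; rewrite ltnS leq_eqVlt stS inE => /predU1P[->|/IH ->].
    by rewrite eqxx.
  by rewrite orbT.
have yphi n : e < phi (y n) by have [] := YP (st n).1.
have yl n z : z \in y n :: (st n).2 -> e < phi z.
  elim: n z => [|n IH] z; first by rewrite mem_seq1 => /eqP->.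
  by rewrite inE => /predU1P[->//|]; rewrite stS; exact: IH.
have xP n := ZP _ (yl n).
apply: (@no_james_sequences p y x e cp) => //.
- by move=> n z; have [] := YP (st n).1.
- by move=> n; have [] := xP n.
- by move=> k n kn; have [_ h _] := YP (st n).1; apply: h; exact: xs.
- move=> n k; have [_ h] := xP k; rewrite leq_eqVlt => /predU1P[->|nk]; apply: h.
    exact: mem_head.
  by rewrite inE ys// orbT.
Qed.

(** The sets [B p e] of points approximating [phi] on the polar of a seminorm generate a Cauchy
    filter, and its limit represents [phi]. The approximation is one-sided, but these polars are
    symmetric. *)
Theorem james_ultra (F : set_system X) : tvs_complete X -> UltraFilter F -> F A ->
  exists x : X, forall y : dual X, (y z : R^o) @[z --> F] --> (y x : R^o).
Proof.
move=> Xc FU FA.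
have /choice[phi Fphi] : forall y : dual X, exists l : R^o,
    (y z : R^o) @[z --> F] --> l.
  move=> y; have [M yM] := attained_bounded y.
  by apply: (@ultra_bounded_cvg R X F y M); apply: filterS FA => a; exact: yM.
have lphi : linear phi.
  move=> a y z.
  have h : ((a *: y + z) x : R^o) @[x --> F] --> a *: phi y + phi z.
    by apply: (@cvgD _ R^o); [apply: cvgZl_tmp|]; exact: Fphi.
  exact: (cvg_unique _ (Fphi _) h).
have phiN y : phi (- y) = - phi y.
  have h : ((- y) x : R^o) @[x --> F] --> - phi y by apply: (@cvgN _ R^o); exact: Fphi.
  exact: (cvg_unique _ (Fphi _) h).
pose B p (e : R) := [set x : X | forall y : dual X, (forall z, y z <= p z :> R) ->
  phi y - y x <= e].
pose G (V : set X) := exists p e, [/\ cseminorm p, 0 < e & B p e `<=` V].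
have GF : ProperFilter G.
  apply: Build_ProperFilter_ex.
    move=> V [p [e [cp e0 BV]]].
    by have [x xP] := dual_limit_approx _ FA lphi Fphi cp e0; exists x; exact: BV.
  split.
  - exists (fun x => `|(0 : dual X) x : R|), 1; split => //; exact: dual_cseminorm.
  - move=> V W [p [e [cp e0 BV]]] [p' [e' [cp' e'0 BW]]].
    exists (fun x => p x + p' x), (Num.min e e'); split.
    + exact: cseminorm_add.
    + by rewrite lt_min e0.
    + move=> x xB; split.
        apply: BV => y yp; have yp' z : y z <= p z + p' z :> R.
          by apply: le_trans (yp z) _; rewrite lerDl cseminorm_ge0.
        by have := xB y yp'; rewrite le_min => /andP[].
      apply: BW => y yp; have yp' z : y z <= p z + p' z :> R.
        by apply: le_trans (yp z) _; rewrite lerDr cseminorm_ge0.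
      by have := xB y yp'; rewrite le_min => /andP[].
  - by move=> V W VW [p [e [cp e0 BV]]]; exists p, e; split => // x /BV /VW.
have Gc : tvs_cauchy G.
  move=> V V0; have [p cp pV] := nbhs0_cseminorm V0.
  exists (B p 3^-1); first by exists p, 3^-1; split => //; rewrite invr_gt0.
  move=> x x' xB xB'; apply: pV.
  have [y [yp yE]] := cseminorm_dual (x - x') cp; rewrite -yE linearB.
  have yNp z : (- y) z <= p z :> R.
    by have [_ pN _] := cp; have := yp (- z); rewrite pN linearN.
  have := xB' _ yp; have := xB _ yNp; rewrite phiN.
  change (- phi y - - (y x : R) <= 3^-1 -> phi y - y x' <= 3^-1 ->
    (y x : R) - y x' < 1).
  by lra.
have [x Gx] := Xc G GF Gc.
exists x => y; suff <- : phi y = y x by exact: Fphi.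
apply/eqP; rewrite -subr_eq0 -normr_le0; apply/ler_addgt0Pr => e e0; rewrite add0r.
have e2 : 0 < e / 2 by rewrite divr_gt0.
have GB : G (B (fun z => `|y z : R|) (e / 2)).
  by exists (fun z => `|y z : R|), (e / 2); split => //; exact: dual_cseminorm.
have Gy : G [set z | `|(y x : R) - y z| <= e / 2].
  apply: Gx; have := @dual_continuous _ _ y x; move=> /(@cvgrPdist_le _ R^o).
  exact.
have [z [zB zy]] := filter_ex (filterI GB Gy).
have h1 := zB y (fun z => ler_norm _).
have yNp t : (- y) t <= `|y t : R|.
  by rewrite -normrN; exact: ler_norm.
have := zB _ yNp; rewrite phiN.
change (- phi y - - (y z : R) <= e / 2 -> `|phi y - (y x : R)| <= e) => h2.
move: zy; rewrite /= !ler_norml => /andP[h3 h4].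
by apply/andP; split; lra.
Qed.

End james.

(** * The weak topology *)

Lemma ultra_fmap {S T : Type} (f : S -> T) (F : set_system S) :
  UltraFilter F -> UltraFilter (f @ F).
Proof.
move=> FU; split=> [|G GF FG]; first exact: fmap_proper_filter.
apply/seteqP; split=> // A GA; have [//|nA] := in_ultra_setVsetC (f @^-1` A) FU.
have /filter_ex[t []//] : G (A `&` ~` A) by apply: filterI => //; exact: FG.
Qed.

Section weak_topology.
Context {R : realType} {X : tvsType R}.
Implicit Types (K C : set X) (F : set_system X).

Definition weak_limit F (x : X) : Prop :=
  forall y : dual X, (y z : R^o) @[z --> F] --> (y x : R^o).

Lemma weakly_compactP K : weakly_compact K <->
  forall F, UltraFilter F -> F K -> exists2 x, K x & weak_limit F x.
Proof.
rewrite /weakly_compact compact_ultra /=; split => h F FU FK.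
  by have [x [Kx /cvg_weak Fx]] := h F FU FK; exists x.
by have [x Kx Fx] := h F FU FK; exists x; split => //; apply/cvg_weak.
Qed.

Lemma weak_limit_convex F C x : ProperFilter F -> segment_convex C -> closed C ->
  F C -> weak_limit F x -> C x.
Proof.
move=> FF vC cC FC Fx; apply: contrapT => nCx.
have [y [e [e0 yC]]] := dual_separation vC cC nCx.
have : - (y x : R) <= - ((y x : R) + e).
  apply: (@cvg_le_bound _ _ F (fun z => - (y z : R))).
    by apply: (@cvgN _ R^o); exact: Fx.
  by apply: filterS FC => z /yC /=; rewrite lerN2.
by lra.
Qed.

Lemma weakly_compact_convex_closed K C : segment_convex C -> closed C -> C `<=` K ->
    (forall F, UltraFilter F -> F K -> exists x, weak_limit F x) ->
  weakly_compact C.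
Proof.
move=> vC cC CK KF; apply/weakly_compactP => F FU FC.
have [|x Fx] := KF F FU; first exact: filterS FC.
by exists x => //; exact: weak_limit_convex Fx.
Qed.

Lemma weakly_compact_max K (y : dual X) : weakly_compact K -> K !=set0 ->
  exists2 k, K k & forall k', K k' -> y k' <= y k :> R.
Proof.
move=> cK K0.
have [|k] := @compact_EVT_max (weak X) R (fun x => y x : R) K K0 cK.
  by apply: continuous_subspaceT => x; exact: weak_dual_continuous.
by rewrite inE => Kk kP; exists k => // k' Kk'; apply: kP; rewrite inE.
Qed.

Lemma dual_separates (x x' : X) : hausdorff_space X ->
  (forall y : dual X, y x = y x') -> x = x'.
Proof.
move=> hX yxx; apply: hX => A B Ax Bx'.
have A0 : nbhs (0 : X) [set z | A (z + x)].
  have := nbhsB (- x) Ax; rewrite addNr; apply: filterS => _ [z Az <-] /=.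
  by rewrite addrAC addNr add0r.
have [p cp pA] := nbhs0_cseminorm A0.
exists x'; split; last exact: nbhs_singleton.
rewrite -[x'](subrK x); apply: pA.
have [y [_ <-]] := cseminorm_dual (x' - x) cp.
have -> : y (x' - x) = y x' - y x by exact: linearB.
by rewrite yxx subrr.
Qed.

Lemma weakly_compact_closed K : hausdorff_space X -> weakly_compact K -> closed K.
Proof.
move=> hX /weakly_compactP cK x clx.
have PF : ProperFilter (within K (nbhs x)).
  by apply: within_nbhs_proper.
have [F [FU xF]] := ultraFilterLemma PF.
have FK : F K by apply: xF; rewrite /within /=; apply: nearW.
have [k Kk Fk] := cK F FU FK.
suff -> : x = k by [].
apply: dual_separates => // y.
have Fx : (y z : R^o) @[z --> F] --> (y x : R^o).
  move=> V /(@dual_continuous _ _ y x) Vx; apply: xF.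
  by apply: (@filterS _ (nbhs x) _ _ _ _ Vx) => z Vz _.
exact: (cvg_unique _ Fx (Fk y)).
Qed.

Lemma mackey_bipolar K (x : X) (c : R) : hausdorff_space X -> mackey_set K -> K 0 ->
    0 < c -> (forall y : dual X, (forall k, K k -> y k <= 1 :> R) -> y x <= c :> R) ->
  [set c *: k | k in K] x.
Proof.
move=> hX [cK _ vK] K0 c0 xP; exists (c^-1 *: x); last first.
  by rewrite scalerA divff ?scale1r// gt_eqF.
apply: contrapT => nK.
have [y [e [e0 yK]]] :=
  dual_separation (segment_convexP vK) (weakly_compact_closed hX cK) nK.
pose v := - (y x : R) / c.
have yv : y (c^-1 *: x) = - v :> R by rewrite linearZ /v mulNr opprK mulrC.
have ve : e <= v by have := yK _ K0; rewrite yv linear0; lra.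
(* On [K], [- y] is at most [v - e], which may be 0. Dividing by [v - e / 2] instead is safe, and
   still gives a value above [c] at [x]. *)
have d0 : 0 < v - e / 2 by lra.
have h k : K k -> (- (v - e / 2)^-1 *: y) k <= 1 :> R.
  move=> /yK; rewrite yv => yk.
  change (- (v - e / 2)^-1 * (y k : R) <= 1).
  by rewrite mulNr -mulrN mulrC ler_pdivrMr//; lra.
have := xP _ h.
change (- (v - e / 2)^-1 * (y x : R) <= c -> False).
have -> : (y x : R) = - (c * v) by rewrite /v; field; rewrite gt_eqF.
rewrite mulrNN mulrC ler_pdivrMr// ler_pM2l//; lra.
Qed.

(** Along an ultrafilter the bounded real coordinate [T] converges. The coordinate is chosen, since
    it is not unique when [x = 0]. *)
Lemma mackey_segment (x : X) : mackey_set [set t *: x | t in [set t : R | `|t| <= 1]].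
Proof.
split.
- apply/weakly_compactP => F FU FS.
  have /choice[T TP] : forall z : X, exists t : R,
      [set t *: x | t in [set t : R | `|t| <= 1]] z -> `|t| <= 1 /\ z = t *: x.
    by move=> z; have [[t t1 <-]|n] := pselect
      ([set t *: x | t in [set t : R | `|t| <= 1]] z); [exists t|exists 0].
  have [t Ft] : exists t : R^o, (T z : R^o) @[z --> F] --> t.
    by apply: (@ultra_bounded_cvg R X F T 1); apply: filterS FS => z /TP[].
  exists (t *: x).
    exists t => //=; apply: (@cvg_le_bound _ _ F (fun z => `|T z|)).
      by apply: (@cvg_norm _ R^o); exact: Ft.
    by apply: filterS FS => z /TP[].
  move=> y; rewrite linearZ.
  have h : (T z * (y x : R) : R^o) @[z --> F] --> (t * (y x : R) : R^o).
    by apply: cvgMr_tmp; exact: Ft.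
  apply: cvg_trans h; apply: near_eq_cvg; apply: filterS FS => z /TP[_ {2}->].
  by rewrite linearZ.
- move=> t _ t1 [s s1 <-]; exists (t * s); last by rewrite scalerA.
  by rewrite /= normrM mulr_ile1.
- move=> _ _ l /set_mem[t /= t1 <-] /set_mem[s /= s1 <-]; apply/mem_set.
  exists (l%:num * t + (1 - l%:num) * s) => /=.
    have l0 : 0 <= l%:num :> R by [].
    have l1 : 0 <= 1 - l%:num :> R by rewrite subr_ge0.
    apply: le_trans (ler_normD _ _) _.
    rewrite !normrM (ger0_norm l0) (ger0_norm l1).
    have := ler_wpM2l l0 t1; have := ler_wpM2l l1 s1; lra.
  by rewrite scalerDl -!scalerA.
Qed.

End weak_topology.

(** * James' theorem for functions *)

Section function_james.
Context {R : realType} {X : tvsType R} (D K : set X) (g : X -> R).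
Hypothesis cK : weakly_compact K.
Hypothesis circledK : circled K.
Hypothesis D0 : D 0.
Hypothesis g0 : g 0 = 0.
Hypothesis gge0 : forall x, D x -> 0 <= g x.
Hypothesis attainedD : forall y : dual X, (forall k, K k -> y k <= 1 :> R) ->
  exists2 x, D x & forall x', D x' -> (y x' : R) - g x' <= y x - g x.

(** For [s > 0], [y <= s] on this set means [y / s - g <= 1] on [D]. This links maxima of linear
    forms on it to the maxima in [attainedD]. *)
Let A' := [set (g x + 1)^-1 *: x | x in D].

Let A'E (y : dual X) x : y ((g x + 1)^-1 *: x) = (y x : R) / (g x + 1) :> R.
Proof. by rewrite linearZ mulrC. Qed.

Lemma perspective_attained (y : dual X) :
  exists2 a, (A' `|` K) a & forall a', (A' `|` K) a' -> y a' <= y a :> R.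
Proof.
have A'0 : A' 0 by exists 0 => //; rewrite scaler0.
have [k [kge0 yK kK]] : exists k : R, [/\ 0 <= k, forall z, K z -> y z <= k :> R &
    exists2 a, (A' `|` K) a & y a = k].
  have [K0|K0] := pselect (K !=set0); last first.
    exists 0; split => // [z Kz|]; first by case: K0; exists z.
    by exists 0; [left|rewrite linear0].
  have [z Kz zP] := weakly_compact_max y cK K0.
  exists (y z); split => //; last by exists z => //; right.
  have := zP (0 *: z); rewrite scale0r linear0; apply.
  by rewrite -(scale0r z); apply: circledK => //; rewrite normr0.
have [hA|/existsNP[_ /not_implyP[[x1 Dx1 <-] /negP]]] :=
  pselect (forall a, A' a -> y a <= k :> R).
  have [a Aa ya] := kK; exists a => // a' [/hA|/yK]; rewrite -ya; exact.
rewrite -ltNge A'E => kx1.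
have g1 x : D x -> 0 < g x + 1 by move=> /gge0; lra.
pose E := [set (y x : R) / (g x + 1) | x in D].
have hE : has_sup E.
  split; first by exists ((y x1 : R) / (g x1 + 1)), x1.
  (* [y / (k + 1)] lies in the polar of [K], so [y / (k + 1) - g] is bounded above on [D]; this
     bounds [E]. *)
  have t0 : 0 < (k + 1)^-1 by rewrite invr_gt0; lra.
  have [|x Dx xP] := @attainedD ((k + 1)^-1 *: y).
    move=> z /yK yz; change ((k + 1)^-1 * (y z : R) <= 1).
    by rewrite mulrC ler_pdivrMr; lra.
  pose c := (k + 1)^-1 * (y x : R) - g x.
  have {}xP x' : D x' -> (k + 1)^-1 * (y x' : R) - g x' <= c by exact: xP.
  exists ((k + 1) * (`|c| + 1)) => _ [x' Dx' <-].
  rewrite ler_pdivrMr ?g1// -mulrA -ler_pdivrMl; last by lra.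
  have := xP _ Dx'; have := ler_norm c; have := gge0 Dx'; have := normr_ge0 c.
  by move: (`|c|) => b; nra.
pose s := sup E.
have sP x : D x -> (y x : R) / (g x + 1) <= s.
  by move=> Dx; apply: ub_le_sup; [exact: hE.2|exists x].
have ks : k < s by apply: lt_le_trans kx1 (sP _ Dx1).
have s0 : 0 < s by lra.
have [|x Dx] := @attainedD (s^-1 *: y).
  move=> z /yK yz; change (s^-1 * (y z : R) <= 1).
  by rewrite mulrC ler_pdivrMr; lra.
pose m := (y x : R) / s - g x.
have -> : (s^-1 *: y) x - g x = m :> R by rewrite /m mulrC.
move=> xm; have {}xm x' : D x' -> (y x' : R) / s - g x' <= m.
  by move=> /xm; rewrite mulrC.
have m0 : 0 <= m by have := xm 0 D0; rewrite linear0 mul0r g0; lra.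
(* If [m >= 1], the maximiser of [y / s - g] reaches the supremum [s]. If [m < 1], there is room to
   enlarge [y / s], against the definition of [s]. *)
have [m1|m1] := leP 1 m.
  exists ((g x + 1)^-1 *: x); first by left; exists x.
  have sx : s <= (y x : R) / (g x + 1).
    rewrite ler_pdivlMr ?g1//; have : g x + 1 <= (y x : R) / s by rewrite /m in m1; lra.
    by rewrite ler_pdivlMr// mulrC.
  rewrite A'E => a' [[x' Dx' <-]|/yK]; last by lra.
  by rewrite A'E; apply: le_trans (sP _ Dx') sx.
exfalso; pose t := 2 * s / (s + k).
have sk : 0 < s + k by lra.
have t1 : 1 < t by rewrite ltr_pdivlMr//; lra.
have [|x2 Dx2] := @attainedD ((t / s) *: y).
  move=> z /yK yz; change (t / s * (y z : R) <= 1).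
  have -> : t / s = 2 / (s + k) by rewrite /t; field; rewrite !gt_eqF.
  by rewrite mulrAC ler_pdivrMr//; lra.
pose m2 := t / s * (y x2 : R) - g x2.
have -> : ((t / s) *: y) x2 - g x2 = m2 :> R by [].
move=> xm2; have {}xm2 x' : D x' -> t * ((y x' : R) / s) - g x' <= m2.
  by move=> /xm2; rewrite [(y x' : R) / s]mulrC mulrA.
(* Makes [(1 - e) * m + e * m2] at most 1. The same combination of the bounds for [y / s] and
   [t * (y / s)] yields the factor [tau > 1]. *)
pose e := (1 - m) / (1 + `|m2|).
have e0 : 0 < e by rewrite divr_gt0//; have := normr_ge0 m2; lra.
have e1 : e <= 1 by rewrite ler_pdivrMr; have := normr_ge0 m2; lra.
have em : e * m2 <= e * (1 + `|m2|) - e.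
  by have := ler_wpM2l (ltW e0) (ler_norm m2); lra.
have eE : e * (1 + `|m2|) = 1 - m.
  by rewrite /e divfK// gt_eqF//; have := normr_ge0 m2; lra.
pose tau := 1 + e * (t - 1).
have tau1 : 1 < tau by rewrite ltrDl mulr_gt0//; lra.
have h x' : D x' -> tau * ((y x' : R) / s) <= g x' + 1.
  move=> Dx'; have h1 := xm _ Dx'; have h2 := xm2 _ Dx'.
  have e1' : 0 <= 1 - e by lra.
  have := ler_wpM2l e1' h1; have := ler_wpM2l (ltW e0) h2.
  by have := mulr_ge0 (ltW e0) m0; rewrite /tau; lra.
have : s <= s / tau.
  apply: ge_sup => [|_ [x' Dx' <-]]; first by exists ((y x1 : R) / (g x1 + 1)), x1.
  rewrite ler_pdivrMr ?g1// mulrAC ler_pdivlMr; last by lra.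
  have := h _ Dx'; rewrite mulrA ler_pdivrMr//; lra.
rewrite ler_pdivlMr; last by lra.
by rewrite ger_pMr//; lra.
Qed.

(** The points [phi x] converge weakly by James' theorem, the factors [g x + 1] converge because
    they are bounded, and the product of the two limits is the required point. *)
Lemma sublevel_weak_limit (lam : R) (F : set_system X) : tvs_complete X ->
    UltraFilter F -> F [set x | D x /\ g x <= lam] ->
  exists x, weak_limit F x.
Proof.
move=> Xc FU Flam.
pose phi x := (g x + 1)^-1 *: x.
have FA : (phi @ F) (A' `|` K).
  by apply: (@filterS _ F _ _ _ _ Flam) => x [Dx _]; left; exists x.
have [a aP] := james_ultra perspective_attained Xc (ultra_fmap phi FU) FA.
have [t Ft] : exists t : R^o, (g x + 1 : R^o) @[x --> F] --> t.
  apply: (@ultra_bounded_cvg R X F _ (lam + 1)); apply: filterS Flam => x [/gge0 h1 h2].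
  by rewrite /= ger0_norm; lra.
exists (t *: a) => y; rewrite linearZ.
have h : ((g x + 1) * (y (phi x) : R) : R^o) @[x --> F] --> (t * (y a : R) : R^o).
  exact: (@cvgM R _ F _ (fun x => g x + 1) (fun x => y (phi x)) _ _ Ft (aP y)).
apply: cvg_trans h; apply: near_eq_cvg; apply: filterS Flam => x [/gge0 h1 _].
by rewrite /phi linearZ mulrA divff ?mul1r// gt_eqF//; lra.
Qed.

End function_james.

(** * Conjugates and sublevel sets *)

Section convex_functions.
Context {R : realType} {X : tvsType R} (f : X -> \bar R).
Hypothesis X_hausdorff : hausdorff_space X.
Hypothesis f_proper : proper_efun f.
Hypothesis f_lsc : lower_semicontinuous f.
Hypothesis f_convex : convex_efun f.
Implicit Types (xs ys : dual X).

Let r x : R := fine (f x).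

Let sublevel xs (lam : R) : set X := [set x | (f x - (xs x : R)%:E <= lam%:E)%E].

Lemma dom_fineE x : dom f x -> f x = (r x)%:E.
Proof. by move=> fx; rewrite fineK// fin_numE (f_proper.1 x)/= lt_eqF. Qed.

Lemma sublevelP xs lam x : sublevel xs lam x <-> dom f x /\ r x - xs x <= lam.
Proof.
split=> [|[fx rx]]; last by rewrite /sublevel /= (dom_fineE fx) -EFinB lee_fin.
rewrite /sublevel /= => h; have fx : dom f x.
  by move: h; rewrite /dom /=; case: (f x) => [s| |] //; rewrite ltry.
by split=> //; move: h; rewrite (dom_fineE fx) -EFinB lee_fin.
Qed.

Lemma conjugate_ge xs x : dom f x -> (((xs x : R) - r x)%:E <= conjugate f xs)%E.
Proof.
move=> fx; apply: ereal_sup_ubound; exists x => //.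
by rewrite (dom_fineE fx) EFinB.
Qed.

Lemma conjugate_leP xs (M : R) :
  (conjugate f xs <= M%:E)%E <-> forall x, dom f x -> (xs x : R) - r x <= M.
Proof.
split=> [h x fx|h].
  by rewrite -lee_fin; apply: le_trans h; exact: conjugate_ge.
apply: ge_ereal_sup => _ [x _ <-]; have := f_proper.1 x.
case fx : (f x) => [s| |] // _; last by rewrite leNye.
have := h x; rewrite /dom /= /r fx ltry => /(_ isT).
by rewrite -EFinB lee_fin.
Qed.

Lemma conjugate_gtNy xs : conjugate f xs != -oo%E.
Proof.
have [_ [x fx]] := f_proper.
by have := conjugate_ge xs fx; case: (conjugate f xs).
Qed.

Lemma dom_conjugateP xs : dom (conjugate f) xs <->
  exists M : R, (conjugate f xs <= M%:E)%E.
Proof.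
rewrite /dom /=; split=> [|[M /le_lt_trans]]; last by apply; rewrite ltry.
by have := conjugate_gtNy xs; case: (conjugate f xs) => // c _ _; exists c.
Qed.

Lemma convex_fine x y (s t : R) : dom f x -> dom f y -> 0 <= s -> 0 <= t ->
  s + t = 1 -> dom f (s *: x + t *: y) /\ r (s *: x + t *: y) <= s * r x + t * r y.
Proof.
move=> fx fy s0 t0 st; have tE : t = 1 - s by lra.
have s01 : 0 <= s <= 1 by rewrite s0/=; lra.
have := f_convex x y s01; rewrite -tE (dom_fineE fx) (dom_fineE fy).
rewrite -!EFinM -EFinD => h.
have fd : dom f (s *: x + t *: y) by apply: le_lt_trans h _; rewrite ltry.
by split=> //; move: h; rewrite (dom_fineE fd) lee_fin.
Qed.

Lemma sublevel_convex xs lam : segment_convex (sublevel xs lam).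
Proof.
move=> x y s t /sublevelP[fx rx] /sublevelP[fy ry] s0 t0 st.
have [fd rd] := convex_fine fx fy s0 t0 st.
apply/sublevelP; split=> //; rewrite linearD !linearZ.
change (r (s *: x + t *: y) - (s * (xs x : R) + t * (xs y : R)) <= lam).
have := ler_wpM2l s0 rx; have := ler_wpM2l t0 ry.
have : lam = s * lam + t * lam by rewrite -mulrDl st mul1r.
by lra.
Qed.

Lemma sublevel_closed xs lam : closed (sublevel xs lam).
Proof.
rewrite -openC openE => x nx.
have {}nx : ((lam + xs x)%:E < f x)%E.
  rewrite ltNge; apply/negP => h; apply: nx; apply/sublevelP.
  have fx : dom f x by apply: le_lt_trans h _; rewrite ltry.
  by split=> //; move: h; rewrite (dom_fineE fx) lee_fin; lra.
have [e e0 ef] : exists2 e : R, 0 < e & ((lam + xs x + e)%:E < f x)%E.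
  move: nx; case: (f x) => [s| |]//.
    rewrite lte_fin => h; exists ((s - (lam + xs x)) / 2); first by rewrite divr_gt0; lra.
    by rewrite lte_fin; lra.
  by move=> _; exists 1 => //; rewrite ltry.
have [V Vx Vf] := f_lsc ef.
have := @dual_continuous _ _ xs x; move=> /(@cvgrPdist_lt _ R^o)/(_ e e0) xe.
apply: filterS2 Vx xe => y /Vf yf; rewrite ltr_norml => /andP[h _] /sublevelP[fy ry].
by move: yf; rewrite (dom_fineE fy) lte_fin; move: h; lra.
Qed.

(** The sublevel sets at levels taken as values generate a filter. A weak limit of a finer
    ultrafilter lies in all of them, as they are closed and convex; boundedness below comes out with
    the minimum. *)
Lemma weakly_inf_compact_min xs :
    weakly_inf_compact (fun x => (f x - (xs x : R)%:E)%E) ->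
  exists2 x, dom f x & forall z, dom f z -> r x - xs x <= r z - xs z.
Proof.
move=> cf; have [_ [x0 fx0]] := f_proper.
pose G (V : set X) := exists2 z, dom f z & sublevel xs (r z - xs z) `<=` V.
have slf z : dom f z -> sublevel xs (r z - xs z) z by move=> fz; apply/sublevelP.
have sll a b : a <= b -> sublevel xs a `<=` sublevel xs b.
  by move=> ab z /sublevelP[fz za]; apply/sublevelP; split=> //; apply: le_trans ab.
have GF : ProperFilter G.
  apply: Build_ProperFilter_ex.
    by move=> V [z fz zV]; exists z; apply: zV; exact: slf.
  split; first by exists x0.
    move=> V W [z fz zV] [z' fz' zW].
    have [zz|/ltW zz] := leP (r z - xs z) (r z' - xs z').
      by exists z => // t tz; split; [exact: zV|apply: zW; exact: sll tz].
    by exists z' => // t tz; split; [apply: zV; exact: sll tz|exact: zW].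
  by move=> V W VW [z fz zV]; exists z => // t /zV /VW.
have [F [FU GFs]] := ultraFilterLemma GF.
have FL z : dom f z -> F (sublevel xs (r z - xs z)) by move=> fz; apply: GFs; exists z.
have /weakly_compactP/(_ F FU (FL _ fx0))[x _ Fx] := cf (r x0 - xs x0).
have xL z : dom f z -> sublevel xs (r z - xs z) x.
  move=> fz; apply: (@weak_limit_convex _ _ F) (FL _ fz) Fx.
    exact: sublevel_convex.
  exact: sublevel_closed.
have /sublevelP[fx _] := xL _ fx0.
by exists x => // z /xL /sublevelP[].
Qed.

(** * Subgradients as minimisers *)

Lemma minimizer_subdifferential xs x : dom f x ->
    (forall z, dom f z -> r x - xs x <= r z - xs z) ->
  inv_subdifferential f xs x.
Proof.
move=> fx xmin; split; first by rewrite (dom_fineE fx).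
move=> z; have := f_proper.1 z; have := xmin z.
rewrite (dom_fineE fx) linearB /dom /r /=.
case: (f z) => [s| |]//; last by rewrite leey.
rewrite ltry => /(_ isT) /= h _; rewrite -EFinD lee_fin.
by rewrite -[(xs z - xs x)]/((xs z : R) - xs x); lra.
Qed.

Lemma subdifferential_minimizer xs x : inv_subdifferential f xs x ->
  dom f x /\ forall z, dom f z -> (xs z : R) - r z <= xs x - r x.
Proof.
move=> [fx h]; have dx : dom f x by rewrite /dom /= -(fineK fx) ltry.
split=> // z fz; have := h z; rewrite (dom_fineE dx) (dom_fineE fz) -EFinD lee_fin.
by rewrite linearB -[(xs z - xs x)]/((xs z : R) - xs x); lra.
Qed.

Lemma subdifferential_weakly_inf_compact (U : set (dual X)) : tvs_complete X ->
    open U -> (forall xs, U xs -> inv_subdifferential f xs !=set0) ->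
  forall xs, U xs -> weakly_inf_compact (fun x => (f x - (xs x : R)%:E)%E).
Proof.
move=> Xc oU cU xs Uxs lam.
have [K [cK bK _] KU] : mackey_nbhs xs U
  := @open_nbhs_nbhs (dual X) xs U (conj oU Uxs).
have [x0 /subdifferential_minimizer[fx0 x0min]] := cU _ Uxs.
(* Moving the minimiser [x0] of [f - xs] to the origin gives [g 0 = 0 = min g]; perturbing [xs] by
   the polar of [K] stays inside [U]. *)
pose D := [set x | dom f (x + x0)].
pose g x := r (x + x0) - xs (x + x0) - (r x0 - xs x0).
have D0 : D 0 by rewrite /D /= add0r.
have g0 : g 0 = 0 by rewrite /g add0r subrr.
have gge0 x : D x -> 0 <= g x by move=> /x0min; rewrite /g; lra.
have gatt (y : dual X) : (forall k, K k -> y k <= 1 :> R) ->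
    exists2 x, D x & forall x', D x' -> (y x' : R) - g x' <= y x - g x.
  move=> yK; have Uy : U (xs + y).
    by apply: KU; apply/polarP; rewrite addrC addKr.
  have [x /subdifferential_minimizer[fx xmin]] := cU _ Uy.
  exists (x - x0); first by rewrite /D /= subrK.
  move=> x' /xmin; rewrite /g subrK.
  change ((xs (x' + x0) : R) + y (x' + x0) - r (x' + x0) <=
     (xs x : R) + y x - r x ->
     (y x' : R) - (r (x' + x0) - xs (x' + x0) - (r x0 - xs x0)) <=
     y (x - x0) - (r x - xs x - (r x0 - xs x0))).
  have -> : (y (x' + x0) : R) = (y x' : R) + y x0 by exact: linearD.
  have -> : (y (x - x0) : R) = (y x : R) - y x0 by exact: linearB.
  by lra.
apply: (@weakly_compact_convex_closed _ _ (sublevel xs lam)) => //.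
- exact: sublevel_convex.
- exact: sublevel_closed.
move=> F FU FL; pose sh (x : X) := x - x0.
have FL' : (sh @ F) [set x | D x /\ g x <= lam - (r x0 - xs x0)].
  apply: (@filterS _ F _ _ _ _ FL) => x /sublevelP[fx rx].
  rewrite /= /D /= /g subrK; split => //.
  by rewrite lerD2r.
have [x xP] := sublevel_weak_limit cK bK D0 g0 gge0 gatt Xc (ultra_fmap sh FU) FL'.
exists (x + x0) => y.
have -> : (fun z => y z : R^o) = (fun z => (y (sh z) : R^o) + y x0).
  by apply/funext => z; rewrite /sh linearB subrK.
by rewrite linearD; apply: (@cvgD _ R^o); [exact: xP|exact: cvg_cst].
Qed.

(** * Duality between bounds on the conjugate and compact sublevel sets *)

Lemma mackey_set_ext0 (K : set X) : mackey_set K ->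
  exists K' : set X, [/\ mackey_set K', K' 0 & K `<=` K'].
Proof.
move=> mK; have [K0|K0] := pselect (K !=set0).
  exists K; split => //; have [z Kz] := K0; have [_ bK _] := mK.
  by rewrite -(scale0r z); apply: bK => //; rewrite normr0.
exists [set t *: (0 : X) | t in [set t : R | `|t| <= 1]]; split.
- exact: mackey_segment.
- by exists 0; rewrite ?scaler0//= normr0.
- by move=> z Kz; case: K0; exists z.
Qed.

Lemma conjugate_bounded_compact xs (K : set X) (M : R) : mackey_set K ->
    (forall ys, polar K ys -> (conjugate f (xs + ys)%R <= M%:E)%E) ->
  weakly_inf_compact (fun x => (f x - (xs x : R)%:E)%E).
Proof.
move=> /mackey_set_ext0[K' [mK' K'0 KK']] fM lam.
have [cK' _ _] := mK'.
(* On the sublevel set, [y x <= M + lam] for every [y] in the polar; the maximum and the summand 1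
   make [c] positive. The bipolar theorem then puts the sublevel set inside [c] times [K']. *)
pose c := Num.max (M + lam) 0 + 1.
have c0 : 0 < c by rewrite ltr_wpDl// le_max lexx orbT.
have /weakly_compactP ccK := @weakly_compact_scale _ _ _ c cK'.
apply: (@weakly_compact_convex_closed _ _ [set c *: k | k in K']).
- exact: sublevel_convex.
- exact: sublevel_closed.
- move=> x /sublevelP[fx rx]; apply: (mackey_bipolar X_hausdorff mK' K'0 c0) => y yK.
  have /fM/conjugate_leP/(_ x fx) : polar K y by apply/polarP => k /KK'; exact: yK.
  change ((xs x : R) + y x - r x <= M -> y x <= c :> R) => h.
  apply: (@le_trans _ _ (M + lam)); first by lra.
  apply: (@le_trans _ _ (Num.max (M + lam) 0)); first by rewrite le_max lexx.
  by rewrite /c lerDl.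
- by move=> F FU /(ccK F FU)[x _ Fx]; exists x.
Qed.

Lemma mackey_set_bounded (K : set X) ys : mackey_set K ->
  exists M : R, forall k, K k -> (ys k : R) <= M.
Proof.
move=> [cK _ _]; have [K0|K0] := pselect (K !=set0).
  by have [k _ kP] := weakly_compact_max ys cK K0; exists (ys k).
by exists 0 => k Kk; case: K0; exists k.
Qed.

(** [xs + ys] is the mean of [z] and [x1 + a *: ys] with weights [1 / (1 + d)] and [d / (1 + d)]. A
    bound on the conjugate at [z] and near [x1] thus becomes one near [xs]. *)
Lemma epi_pointed_weakly_inf_compact (U : set (dual X)) : open U ->
    epi_pointed f -> U `<=` dom (conjugate f) ->
  forall xs, U xs -> weakly_inf_compact (fun x => (f x - (xs x : R)%:E)%E).
Proof.
move=> oU [_ [x1 dx1 cx1]] Ud xs Uxs.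
have [c1 x1c] := (dom_conjugateP x1).1 dx1.
have [K1 mK1 K1P] : mackey_nbhs x1 [set ys | (conjugate f ys < (c1 + 1)%:E)%E].
  apply: (cx1 [set e | (e < (c1 + 1)%:E)%E]).
  apply: open_nbhs_nbhs; split; first exact: open_ereal_lt_ereal.
  by apply: le_lt_trans x1c _; rewrite lte_fin ltrDl.
have [K2 mK2 K2P] : mackey_nbhs xs U
  := @open_nbhs_nbhs (dual X) xs U (conj oU Uxs).
have [M2 M2P] := mackey_set_bounded (xs - x1) mK2.
(* Small enough that [z], beyond [xs] on the ray from [x1], stays in [U]. *)
pose d := (`|M2| + 1)^-1.
have d0 : 0 < d by rewrite invr_gt0; have := normr_ge0 M2; lra.
pose z := xs + d *: (xs - x1).
have Uz : U z.
  apply: K2P; apply/polarP => k /M2P h; rewrite /z addrC addKr.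
  change (d * ((xs - x1) k : R) <= 1).
  rewrite mulrC /d ler_pdivrMr; last by have := normr_ge0 M2; lra.
  by have := ler_norm M2; lra.
have [cz zc] := (dom_conjugateP z).1 (Ud _ Uz).
pose a := (1 + d) / d.
pose M := (1 + d)^-1 * (cz + d * (c1 + 1)).
apply: (@conjugate_bounded_compact _ [set a *: k | k in K1] M).
  exact: mackey_setZ.
move=> ys /polarP yK; apply/conjugate_leP => x fx.
have h1 := (conjugate_leP _ _).1 zc x fx.
have h2 : ((x1 + a *: ys) x : R) - r x <= c1 + 1.
  apply: (conjugate_leP _ _).1 fx; apply: ltW; apply: K1P; apply/polarP => k Kk.
  rewrite addrC addKr; have := yK _ (imageP _ Kk); rewrite linearZ; exact.
move: h1 h2; change ((xs x : R) + d * ((xs x : R) - x1 x) - r x <= cz ->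
  (x1 x : R) + a * ys x - r x <= c1 + 1 -> (xs x : R) + ys x - r x <= M) => h1 h2.
rewrite /M mulrC ler_pdivlMr; last by lra.
have := ler_wpM2l (ltW d0) h2.
have -> : d * ((x1 x : R) + a * ys x - r x) =
    d * (x1 x : R) + (1 + d) * ys x - d * r x by rewrite /a; field; rewrite gt_eqF.
by lra.
Qed.

Lemma weakly_inf_compact_conjugate xs :
    weakly_inf_compact (fun x => (f x - (xs x : R)%:E)%E) ->
  exists c : R, [/\ conjugate f xs = c%:E,
    exists2 x, dom f x & (xs x : R) - r x = c &
    exists K, mackey_set K /\
      forall ys, polar K ys -> (conjugate f (xs + ys)%R <= (c + 2)%:E)%E].
Proof.
move=> cf; have [x0 fx0 x0min] := weakly_inf_compact_min cf.
pose c := (xs x0 : R) - r x0; exists c; split.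
- apply/eqP; rewrite eq_le conjugate_ge// andbT; apply/conjugate_leP => x fx.
  by have := x0min _ fx; rewrite /c; lra.
- by exists x0.
pose L := sublevel xs (1 - c).
have cL : weakly_compact L := cf _.
have Lx0 : L x0 by apply/sublevelP; split => //; rewrite /c; lra.
pose K := [set a + b | a in L & b in [set (-1) *: x | x in L]].
have KL a b : L a -> L b -> K (a - b).
  by move=> La Lb; exists a => //; exists (- b) => //; exists b; rewrite ?scaleN1r.
have vL : segment_convex L by exact: sublevel_convex.
have mK : mackey_set K.
  split.
  - by apply: weakly_compact_add => //; exact: weakly_compact_scale.
  - move=> t _ t1 [a La [_ [b Lb <-] <-]].
    (* Weights with [p + q = 1] and [p - q = t], so that [t] times a difference of points of [L] is
       again such a difference. *)
    pose p := (1 + t) / 2; pose q := (1 - t) / 2.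
    move: t1; rewrite ler_norml => /andP[t1 t2].
    have p0 : 0 <= p by rewrite divr_ge0//; lra.
    have q0 : 0 <= q by rewrite divr_ge0//; lra.
    have pq : p + q = 1 by rewrite /p /q; lra.
    have -> : t *: (a + -1 *: b) = (p *: a + q *: b) - (p *: b + q *: a).
      have -> : t = p - q by rewrite /p /q; lra.
      rewrite scaleN1r scalerBr !scalerBl opprB opprD.
      by rewrite [- (p *: b) - _]addrC [RHS]addrACA.
    by apply: KL; exact: vL.
  - move=> _ _ l /set_mem[a La [_ [b Lb <-] <-]] /set_mem[a' La' [_ [b' Lb' <-] <-]].
    apply/mem_set; rewrite !scaleN1r.
    have l1 : 0 <= 1 - l%:num :> R by rewrite subr_ge0.
    have -> : conv l (a - b : convex_lmodType X) (a' - b' : convex_lmodType X) =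
        (l%:num *: a + (1 - l%:num) *: a') - (l%:num *: b + (1 - l%:num) *: b').
      by rewrite /conv /= !scalerBr opprD addrACA.
    by apply: KL; apply: vL => //; rewrite addrC subrK.
(* The set [L - L] controls [ys] on differences only; the segment through [x0] controls [ys x0]. *)
have [K' mK' K'P] := mackey_setI mK (mackey_segment x0).
exists K'; split => // ys /K'P[/polarP ysK /polarP ysx0].
apply/conjugate_leP => x fx.
pose h := r x - xs x + c.
have h0 : 0 <= h by have := x0min _ fx; rewrite /h /c; lra.
have y0 : (ys x0 : R) <= 1 by apply: ysx0; exists 1; rewrite ?scale1r//= normr1.
suff : (ys x : R) - ys x0 <= 1 + h.
  change ((ys x : R) - ys x0 <= 1 + h -> (xs x : R) + ys x - r x <= c + 2).
  by rewrite /h; lra.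
have [h1|h1] := leP h 1.
  have Lx : L x by apply/sublevelP; split => //; move: h1; rewrite /h; lra.
  have := ysK _ (KL _ _ Lx Lx0); rewrite linearB.
  by change ((ys x : R) - ys x0 <= 1 -> (ys x : R) - ys x0 <= 1 + h); lra.
have hi0 : 0 <= h^-1 by rewrite invr_ge0.
have hi1 : 0 <= 1 - h^-1 by rewrite subr_ge0 invf_le1 ?ltW//; lra.
have [fz rz] := convex_fine fx fx0 hi0 hi1 (ltac:(by rewrite addrC subrK)).
(* By convexity, shrinking [x] towards [x0] by its excess [h > 1] lands in [L]. So
   [ys (x - x0) <= h], and [f] pays for this growth. *)
pose z := h^-1 *: x + (1 - h^-1) *: x0.
have hh : h^-1 * h = 1 by rewrite mulVf// gt_eqF//; lra.
have Lz : L z.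
  apply/sublevelP; split => //; rewrite linearD !linearZ.
  change (r z - (h^-1 * (xs x : R) + (1 - h^-1) * xs x0) <= 1 - c).
  have : h^-1 * h = h^-1 * (r x) - h^-1 * xs x + h^-1 * c by rewrite /h; ring.
  by move: rz; rewrite -/z hh /c; lra.
have := ysK _ (KL _ _ Lz Lx0).
have -> : ys (z - x0) = h^-1 * ((ys x : R) - ys x0) :> R.
  rewrite /z linearB linearD !linearZ.
  change (h^-1 * (ys x : R) + (1 - h^-1) * ys x0 - ys x0 = h^-1 * ((ys x : R) - ys x0)).
  by ring.
by rewrite mulrC ler_pdivrMr; lra.
Qed.

End convex_functions.

(** A convex function bounded above near a point is continuous there: writing [ys = xs + s *: u],
    the bound [c + 2] at [xs + u] and [xs - u] keeps the conjugate within [s * 2] of [c]. *)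
Lemma conjugate_continuous (R : realType) (X : tvsType R) (f : X -> \bar R)
    (f_proper : proper_efun f) (xs : dual X) (c : R) (x : X) (K : set X) :
    conjugate f xs = c%:E -> dom f x -> (xs x : R) - fine (f x) = c ->
    mackey_set K ->
    (forall ys, polar K ys -> (conjugate f (xs + ys)%R <= (c + 2)%:E)%E) ->
  {for xs, continuous (conjugate f)}.
Proof.
move=> fc fx xc mK fK; rewrite /prop_for /continuous_at fc.
have [_ bK _] := mK.
have near_xs (s : R) : 0 < s -> s <= 1 ->
    \forall ys \near xs, exists2 d : R, conjugate f ys = d%:E & `|c - d| <= s * 2.
  move=> s0 s1; exists [set s^-1 *: k | k in K]; first exact: mackey_setZ.
  move=> ys /polarP yK; pose u := s^-1 *: (ys - xs).
  have uK k : K k -> `|u k : R| <= 1.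
    move=> Kk; have yu z : K z -> u z <= 1 :> R.
      by move=> Kz; have := yK _ (imageP _ Kz); rewrite linearZ.
    rewrite ler_norml yu// andbT lerNl.
    have : K (-1 *: k) by apply: bK => //; rewrite normrN1.
    by rewrite scaleN1r => /yu; rewrite linearN.
  have ysE z : (ys z : R) = xs z + s * u z.
    change ((ys z : R) = xs z + s * (s^-1 * ((ys z : R) - xs z))).
    by rewrite mulrA divff ?mul1r ?gt_eqF// addrC subrK.
  have /(conjugate_leP f_proper) up : (conjugate f (xs + u)%R <= (c + 2)%:E)%E.
    by apply: fK; apply/polarP => k /uK; apply: le_trans; exact: ler_norm.
  have /(conjugate_leP f_proper) lo : (conjugate f (xs - u)%R <= (c + 2)%:E)%E.
    apply: fK; apply/polarP => k /uK; apply: le_trans.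
    by rewrite -normrN; exact: ler_norm.
  have /(conjugate_leP f_proper) mid : (conjugate f xs <= c%:E)%E by rewrite fc.
  have ub : (conjugate f ys <= (c + s * 2)%:E)%E.
    apply/(conjugate_leP f_proper) => z fz; rewrite ysE.
    have s1' : 0 <= 1 - s by lra.
    have := ler_wpM2l s1' (mid _ fz); have := ler_wpM2l (ltW s0) (up _ fz).
    change (s * ((xs z : R) + u z - fine (f z)) <= s * (c + 2) ->
      (1 - s) * ((xs z : R) - fine (f z)) <= (1 - s) * c ->
      (xs z : R) + s * u z - fine (f z) <= c + s * 2).
    by lra.
  (* The supremum is tested at [x], where it is attained for [xs]; the bound at [xs - u] gives
     [u x >= - 2]. *)
  have lb : ((c - s * 2)%:E <= conjugate f ys)%E.
    apply: le_trans (conjugate_ge f_proper ys fx); rewrite lee_fin ysE.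
    have := ler_wpM2l (ltW s0) (lo _ fx).
    change (s * ((xs x : R) - u x - fine (f x)) <= s * (c + 2) ->
      c - s * 2 <= (xs x : R) + s * u x - fine (f x)).
    have -> : fine (f x) = (xs x : R) - c by lra.
    by lra.
  move: ub lb; case: (conjugate f ys) => [d| |] //.
  rewrite !lee_fin => ub lb; exists d => //.
  by rewrite ler_norml; apply/andP; split; lra.
apply/(@fine_cvgP R (dual X) (nbhs xs) _ (conjugate f)); split.
  by apply: (filterS _ (near_xs 1 ltr01 (lexx _))) => ys [d dE _]; rewrite /= dE.
apply/(@cvgrPdist_le _ R^o) => e e0.
have s0 : 0 < Num.min (e / 2) 1 by rewrite lt_min ltr01 divr_gt0.
have s1 : Num.min (e / 2) 1 <= 1 by rewrite ge_min lexx orbT.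
apply: filterS (near_xs _ s0 s1) => ys [d /= -> /le_trans]; apply.
by rewrite -ler_pdivlMr// ge_min lexx.
Qed.

Unset Implicit Arguments.

Theorem corollary3p11 (R : realType) (X : tvsType R)
    (X_hausdorff : hausdorff_space X) (X_complete : tvs_complete X)
    (f : X -> \bar R) (f_proper : proper_efun f)
    (f_lsc : lower_semicontinuous f) (f_convex : convex_efun f)
    (U : set (dual X)) (U_nonempty : U !=set0) (U_open : open U) :
  let a := epi_pointed f /\ U `<=` dom (conjugate f) in
  let b := forall xs, U xs ->
             weakly_inf_compact (fun x => (f x - (xs x : R)%:E)%E) in
  let c := forall xs, U xs -> inv_subdifferential f xs !=set0 in
  (a <-> b) /\ (b <-> c).
Proof.
move=> a b c.
have ab : a -> b.
  move=> [ef Ud] xs.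
  exact: (epi_pointed_weakly_inf_compact X_hausdorff _ _ _ U_open ef Ud).
have bc : b -> c.
  move=> hb xs /hb /(weakly_inf_compact_min f_proper f_lsc f_convex)[x fx xmin].
  by exists x; exact: minimizer_subdifferential.
have cb : c -> b.
  by move=> hc; exact: (subdifferential_weakly_inf_compact _ _ _ X_complete U_open hc).
have ba : b -> a.
  move=> hb.
  have hU xs Uxs :=
    weakly_inf_compact_conjugate f_proper f_lsc f_convex (hb xs Uxs).
  have Ud : U `<=` dom (conjugate f).
    by move=> xs /hU[d [dE _ _]]; rewrite /dom /= dE ltry.
  split => //; have [xs Uxs] := U_nonempty; split.
    by split; [exact: conjugate_gtNy|exists xs; exact: Ud].
  exists xs; first exact: Ud.
  have [d [dE [x fx xd] [K [mK KP]]]] := hU _ Uxs.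
  exact: conjugate_continuous dE fx xd mK KP.
by split; split.
Qed.
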